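(* Let $Z$ be a random variable with values in $\{1,2,\dots\}$, $\mu:=\mathbf{E}[Z]>1$ and $\mathbf{E}[Z^4]<\infty$, and let $\mathbf{T}$ be a Galton-Watson tree with progeny distribution $Z$. Let $p_c=1/\mu$. Then almost surely (for almost every $\mathbf{T}$), for every $n\ge 0$ and every subtree $t$ of $\mathbf{T}[n]$ containing the root, $$\lim_{M\to\infty}\mathbf{P}_{\mathbf{T}}\big[\mathcal{C}_{p_c}[n]=t \,\big|\, \mathbf{0}\leftrightarrow \mathbf{T}_M\big]=\frac{\sum_{v\in t_n}W(v)}{W}\,\mathbf{P}_{\mathbf{T}}\big[\mathcal{C}_{p_c}[n]=t\big].$$ Moreover, for almost every $\mathbf{T}$ there is a unique probability measure $\mu_{\mathbf{T}}$ on infinite rooted subtrees of $\mathbf{T}$ (containing the root of $\mathbf{T}$) whose marginals are given by $$\mu_{\mathbf{T}}\big[\{S: S[n]=t\}\big]=\frac{\sum_{v\in t_n}W(v)}{W}\,\mathbf{P}_{\mathbf{T}}\big[\mathcal{C}_{p_c}[n]=t\big]$$ for all $n\ge 0$ and all subtrees $t$ of $\mathbf{T}[n]$ containing the root.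
   Context: The Galton-Watson tree $\mathbf{T}$ is the random rooted tree with root $\mathbf{0}$ in which every vertex independently has a number of children distributed as $Z$. $\mathbf{T}_M$ is the set of vertices at depth $M$. For a rooted tree $S$, $S[n]$ is the restriction of $S$ to vertices of depth at most $n$; $t_n$ is the set of vertices of $t$ at depth $n$. With $Z_n=|\mathbf{T}_n|$, $W:=\lim_n Z_n/\mu^n$ (an almost sure limit); for a vertex $v$, $W(v):=\lim_k Z_k(v)/\mu^k$, where $Z_k(v)$ is the number of descendants of $v$ exactly $k$ generations below $v$. Given $\mathbf{T}$, in $p_c$ percolation each edge is independently open with probability $p_c$; $\mathbf{P}_{\mathbf{T}}$ is the conditional (quenched) probability given $\mathbf{T}$, $\mathcal{C}_{p_c}$ is the open cluster of the root, and $\{\mathbf{0}\leftrightarrow\mathbf{T}_M\}$ is the event that the root is connected by an open path to some vertex of $\mathbf{T}_M$. The random subtree of $\mathbf{T}$ with law $\mu_{\mathbf{T}}$ is called the incipient infinite cluster of $\mathbf{T}$. The space of infinite rooted subtrees carries the $\sigma$-algebra generated by the sets $\{S: S[n]=t\}$. *)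

(* Defs.v *)
From HB Require Import structures.
From Stdlib Require Import Relation_Operators.
From mathcomp Require Import all_boot all_order all_algebra.
From mathcomp Require Import finmap.
From mathcomp Require Import all_classical all_reals all_analysis.
Import Order.TTheory GRing.Theory Num.Theory.
Import numFieldNormedType.Exports.

Set Implicit Arguments.
Unset Strict Implicit.
Unset Printing Implicit Defensive.

Local Open Scope classical_set_scope.
Local Open Scope ring_scope.

(* Mutual independence: the product rule on every finite subfamily. *)
Definition mutually_independent d d' (Omega : measurableType d)
    (E : measurableType d') (R : realType) (P : probability Omega R)
    (I : choiceType) (X : I -> Omega -> E) : Prop :=
  forall (F : {fset I}) (A : I -> set E), (forall i, measurable (A i)) ->
    P (\bigcap_(i in [set` F]) X i @^-1` A i) =
    (\prod_(i <- enum_fset F) P (X i @^-1` A i))%E.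

(* Ulam-Harris labels: the root is [::] and the i-th child of v is rcons v i,
   so the depth of v is size v. *)
Notation vertex := (seq nat).

(* The tree in which v has the children rcons v i, i < c v. *)
Definition gw_tree (c : vertex -> nat) : set vertex :=
  [set v | forall k, (k < size v)%N -> (nth 0%N v k < c (take k v))%N].

Definition rooted_tree (S : set vertex) : Prop :=
  S [::] /\ forall v i, S (rcons v i) -> S v.

(* S[n] *)
Definition tree_trunc (n : nat) (S : set vertex) : set vertex :=
  [set v | S v /\ (size v <= n)%N].

(* S_n *)
Definition generation (n : nat) (S : set vertex) : set vertex :=
  [set v | S v /\ size v = n].

(* Z_k(v) *)
Definition num_desc (T : set vertex) (v : vertex) (k : nat) : nat :=
  #|` fset_set [set u | [/\ T u, prefix v u & size u = (size v + k)%N]] |.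

(* W(v), with W = W([::]) *)
Definition Wlim (R : realType) (mu : R) (T : set vertex) (v : vertex) : R :=
  limn (fun k => (num_desc T v k)%:R / mu ^+ k).

(* An edge is named by its lower endpoint: b v is the state of the edge
   between v and its parent. *)
Definition open_edge (T : set vertex) (b : vertex -> bool) (u v : vertex) :
    Prop :=
  [/\ T u, T v & exists i, v = rcons u i /\ b v].

(* The connected component of the root in the graph of open edges of T. *)
Definition open_cluster (T : set vertex) (b : vertex -> bool) : set vertex :=
  [set v | clos_refl_sym_trans vertex (open_edge T b) [::] v].

Section percolation.
Context d (Xi : measurableType d) (R : realType) (Q : probability Xi R).
Variables (B : vertex -> Xi -> bool) (T : set vertex).

Definition cluster_event (n : nat) (t : set vertex) : set Xi :=
  [set x | tree_trunc n (open_cluster T (B ^~ x)) = t].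

Definition connect_event (M : nat) : set Xi :=
  [set x | exists2 v, generation M T v & open_cluster T (B ^~ x) v].

Definition cluster_prob (n : nat) (t : set vertex) : R :=
  fine (Q (cluster_event n t)).

Definition cond_cluster_prob (M n : nat) (t : set vertex) : R :=
  fine (Q (cluster_event n t `&` connect_event M)) / fine (Q (connect_event M)).

Definition iic_marginal (mu : R) (n : nat) (t : set vertex) : R :=
  (\sum_(v \in generation n t) Wlim mu T v) / Wlim mu T [::] * cluster_prob n t.

End percolation.

Record inf_tree := InfTree {
  tree_set :> set vertex ;
  inf_tree_rooted : rooted_tree tree_set ;
  inf_tree_infinite : infinite_set tree_set }.

Lemma setT_rooted : rooted_tree [set: vertex].
Proof. by []. Qed.

Lemma setT_infinite : infinite_set [set: vertex].
Proof.
move=> fV; apply: infinite_nat.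
have inj : {in (fun n : nat => [:: n] : vertex) @^-1` [set: vertex] &,
    injective (fun n : nat => [:: n] : vertex)} by move=> m n _ _ [].
by have := finite_preimage inj fV; rewrite preimage_setT.
Qed.

HB.instance Definition _ := gen_eqMixin inf_tree.
HB.instance Definition _ := gen_choiceMixin inf_tree.
HB.instance Definition _ :=
  isPointed.Build inf_tree (InfTree setT_rooted setT_infinite).

Definition tree_cylinder (n : nat) (t : set vertex) : set inf_tree :=
  [set S : inf_tree | tree_trunc n S = t].

Definition tree_cylinders : set (set inf_tree) :=
  [set A | exists n t, A = tree_cylinder n t].

Definition tree_space := g_sigma_algebraType tree_cylinders.

(* A measure on the infinite rooted subtrees of T is one on all infinite rooted
   trees that is concentrated on those contained in T (the library's measurable
   types are pointed, while T need not have any infinite subtree). *)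
Definition is_iic_measure d (Xi : measurableType d) (R : realType)
    (Q : probability Xi R) (B : vertex -> Xi -> bool) (mu : R)
    (T : set vertex) (nu : probability tree_space R) : Prop :=
  nu [set S : inf_tree | (S : set vertex) `<=` T] = 1%E /\
  forall n (t : set vertex), t `<=` tree_trunc n T -> rooted_tree t ->
    nu (tree_cylinder n t) = (iic_marginal Q B T mu n t)%:E.

(* Main.v *)
Require Import Defs.
From HB Require Import structures.
From Stdlib Require Import Relation_Operators.
From mathcomp Require Import all_boot all_order all_algebra.
From mathcomp Require Import finmap.
From mathcomp Require Import all_classical all_reals all_analysis.
From mathcomp Require Import measurable_realfun.
From mathcomp Require Import ring lra zify.
Import Order.TTheory GRing.Theory Num.Theory.
Import numFieldNormedType.Exports.

(* Write q_k(v) for the quenched probability that v is joined to the k-th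
   generation below it.  Given C[n] = t, the root is joined to T_(n+k) iff some
   v in t_n is joined to its k-th generation, and these events depend on
   disjoint sets of edges, so the conditional probability is
   P[C[n] = t] (1 - prod_(v in t_n) (1 - q_k(v))) / q_(n+k)(root), and it
   suffices that, almost surely, q_k(v) / c_k -> W(v) > 0 for all v, where
   c_k = E q_k.  With W_k = Z_k / mu^k and Delta_k = q_k - c_k W_k, inclusion-
   exclusion over the children x of the root gives
     Delta_(k+1) = mu^-1 sum_x Delta_k(x) + (c_k - c_(k+1)) W_(k+1) - rem_k
   with 0 <= rem_k <= mu^-2 sum_(x < y) q_k(x) q_k(y).  The terms of the first
   sum are centred and independent, so it contracts the second moment by mu^-1,
   while the other terms are O(c_k^2) in L^2 (this uses E Z^4 < oo).  Hence
   E (q_k / c_k - W_k)^2 = O(c_k^2), which is summable since c_k - c_(k+1) is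
   bounded below by a multiple of c_k^2.

   For the measure mu_T, the limits of the conditional probabilities of the
   patterns "which of the first j vertices of T belong to the cluster" are
   additive in the pattern; splitting [0, 1[ successively into intervals of these
   lengths realizes mu_T as an image of Lebesgue measure. *)

Set Implicit Arguments.
Unset Strict Implicit.
Unset Printing Implicit Defensive.

Local Open Scope classical_set_scope.
Local Open Scope ring_scope.

(** * Independence of the sigma-algebras of disjoint sets of coordinates *)

(** Both second-moment estimates rest on one principle: in D_(k+1) <= r D_k + C b_k with r < 1, the
    forcing term prevails as soon as b_(k+1) / b_k stays close to 1. It is used with b_k = c_k^2, to
    get E q_k^2 = O(c_k^2) and thereby control of the remainder, and with b_k = c_k^4 for Delta_k.
    The condition on b_k holds because c_k - c_(k+1) is also bounded above by a multiple of c_k^2.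
    The same fact gives c_(n+k) / c_k -> 1, needed because the numerator of the conditional
    probability is of order c_k and its denominator of order c_(n+k). Positivity of W is not read
    off the second moments alone: they only bound P[W_k < 1/2] away from 1. The branching improves
    this to geometric decay of P[W_k < mu^-j / 2] in j, uniformly in k >= j, which excludes W = 0.
    Everything is proved at the root, for a field of offspring numbers indexed by all labels; its
    law is invariant under passing to a subtree and the labels are countable, so one null set serves
    all v, n and t. *)

Definition cylinders d' (Omega : Type) (E : measurableType d') (I : choiceType)
    (X : I -> Omega -> E) (F : set I) : set (set Omega) :=
  [set A | exists (K : {fset I}) (S : I -> set E), [/\ [set` K] `<=` F,
     forall i, measurable (S i) & A = \bigcap_(i in [set` K]) X i @^-1` S i]].

Section independence.
Context d d' (Omega : measurableType d) (E : measurableType d') (R : realType).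
Variable P : probability Omega R.

(** The restriction of [P] to [A] and the multiple [P A] of [P] are finite measures that agree on
    the pi-system [C], hence on the sigma-algebra it generates. *)
Lemma indep_sigma_algebra (C : set (set Omega)) (A : set Omega) :
  C `<=` measurable -> setI_closed C -> C setT -> measurable A ->
  (forall B, C B -> P (A `&` B) = (P A * P B)%E) ->
  forall B, <<s C >> B -> P (A `&` B) = (P A * P B)%E.
Proof.
move=> Cm CI CT mA AC.
have PAfin : P A \is a fin_num by exact: fin_num_measure.
have r0 : 0 <= fine (P A) by rewrite fine_ge0.
pose m1 : {measure set Omega -> \bar R} := mrestr P mA.
pose m2 : {measure set Omega -> \bar R} := mscale (NngNum r0) P.
move=> B CB; suff: m1 B = m2 B by rewrite /m1 /m2 /= /mrestr /mscale /= fineK// setIC.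
apply: (g_sigma_algebra_measure_unique C Cm (fun=> setT)) => //.
- by rewrite bigcup_const.
- by move=> D CD; rewrite /m1 /m2 /= /mrestr /mscale /= setIC AC// fineK.
- by move=> _; rewrite /m1/= /mrestr setTI ltey_eq PAfin.
Qed.

Variables (I : choiceType) (X : I -> Omega -> E).
Hypothesis mX : forall i, measurable_fun setT (X i).
Hypothesis indX : mutually_independent P X.

Lemma measurable_preim i (S : set E) : measurable S -> measurable (X i @^-1` S).
Proof. by move=> mS; rewrite -[X in measurable X]setTI; exact: mX. Qed.

Lemma measurable_fbigcap (K : {fset I}) (S : I -> set E) :
  (forall i, measurable (S i)) ->
  measurable (\bigcap_(i in [set` K]) X i @^-1` S i).
Proof.
move=> mS; apply: fin_bigcap_measurable => // i _; exact: measurable_preim.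
Qed.

Lemma cylinders_measurable F : cylinders X F `<=` measurable.
Proof. by move=> _ [K [S [_ mS ->]]]; exact: measurable_fbigcap. Qed.

(* Two cylinders are merged by putting [setT] on the missing coordinates. *)
Lemma bigcap_fsetU (K L : {fset I}) (S T : I -> set E) :
  (\bigcap_(i in [set` K]) X i @^-1` S i) `&`
  (\bigcap_(i in [set` L]) X i @^-1` T i) =
  \bigcap_(i in [set` (K `|` L)%fset]) X i @^-1`
    ((if i \in K then S i else setT) `&` (if i \in L then T i else setT)).
Proof.
apply/seteqP; split => w /=.
  move=> [wS wT] i /=; rewrite inE => iKL; split.
    by case: ifPn => // iK; exact: wS.
  by case: ifPn => // iL; exact: wT.
move=> h; split=> i /= iK.
  by have := h i; rewrite /= inE iK => /(_ isT) [].
by have := h i; rewrite /= inE iK orbT => /(_ isT) [].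
Qed.

Lemma cylinders_setI F : setI_closed (cylinders X F).
Proof.
move=> _ _ [K [S [KF mS ->]]] [L [T [LF mT ->]]]; rewrite bigcap_fsetU.
exists (K `|` L)%fset, (fun i => (if i \in K then S i else setT) `&`
  (if i \in L then T i else setT)); split => //.
- by move=> i /=; rewrite inE => /orP[/KF|/LF].
- by move=> i; apply: measurableI; case: ifPn.
Qed.

Lemma cylinders_setT F : cylinders X F setT.
Proof.
exists fset0, (fun=> setT); split => //.
by apply/seteqP; split.
Qed.

Lemma cylinder_preim F i (S : set E) : F i -> measurable S ->
  <<s cylinders X F >> (X i @^-1` S).
Proof.
move=> Fi mS; apply: sub_sigma_algebra.
exists [fset i]%fset, (fun=> S); split => //.
- by move=> j /=; rewrite inE => /eqP ->.
- by rewrite set_fset1 bigcap_set1.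
Qed.

Lemma indep_cylinders (F G : set I) (A B : set Omega) :
  F `&` G = set0 -> cylinders X F A -> cylinders X G B ->
  P (A `&` B) = (P A * P B)%E.
Proof.
move=> FG0 [K [S [KF mS ->]]] [L [T [LG mT ->]]].
have KL i : i \in K -> i \in L -> False.
  by move=> iK iL; rewrite -[False]/(set0 i) -FG0; split; [exact: KF|exact: LG].
rewrite bigcap_fsetU indX; last first.
  by move=> i; apply: measurableI; case: ifPn.
rewrite !indX//.
have pKL : perm_eq (K `|` L)%fset (enum_fset K ++ enum_fset L).
  apply: uniq_perm => [||i]; rewrite ?fset_uniq//.
    rewrite cat_uniq !fset_uniq andbT /=; apply/hasPn => i /= iL.
    by apply/negP => iK; exact: KL iK iL.
  by rewrite inE mem_cat.
rewrite (perm_big _ pKL) big_cat/=; congr (_ * _)%E; apply: eq_big_seq => i iK.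
  rewrite iK ifF ?setIT//; apply/negP => iL; exact: KL iK iL.
rewrite iK ifF ?setTI//; apply/negP => iL; exact: KL iL iK.
Qed.

Lemma sub_sigma_measurable (C : set (set Omega)) :
  C `<=` measurable -> <<s C >> `<=` measurable.
Proof. by apply: smallest_sub; exact: sigma_algebra_measurable. Qed.

(** [indep_sigma_algebra] is used twice: with a cylinder over [G] fixed, to pass from cylinders to
    [A], and with this [A] fixed, to pass from cylinders to [B]. *)
Lemma indep_sigma_cylinders (F G : set I) (A B : set Omega) :
  F `&` G = set0 -> <<s cylinders X F >> A -> <<s cylinders X G >> B ->
  P (A `&` B) = (P A * P B)%E.
Proof.
move=> FG0 sA.
have mF := @cylinders_measurable F; have mG := @cylinders_measurable G.
apply: indep_sigma_algebra => //; first exact: cylinders_setI.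
- exact: cylinders_setT.
- exact: (sub_sigma_measurable mF).
- move=> C GC; rewrite setIC muleC.
  move: A sA; apply: indep_sigma_algebra => //; first exact: cylinders_setI.
  + exact: cylinders_setT.
  + exact: mG.
  + by move=> A FA; rewrite setIC muleC; exact: indep_cylinders FG0 FA GC.
Qed.

(** The sample space with the sub-sigma-algebra of the coordinates in [F]. Giving a measurable
    function the domain [cyl_type F] says that it is determined by these coordinates. *)
Definition cyl_type (F : set I) := g_sigma_algebraType (cylinders X F).

Lemma cyl_type_measurable d1 (V : measurableType d1) F (Y : Omega -> V) :
  measurable_fun setT (Y : cyl_type F -> V) -> measurable_fun setT Y.
Proof.
move=> mY _ A mA; rewrite setTI; apply: (sub_sigma_measurable (@cylinders_measurable F)).
by have := mY measurableT A mA; rewrite setTI.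
Qed.

Lemma coord_cyl_type F i : F i -> measurable_fun setT (X i : cyl_type F -> E).
Proof. by move=> Fi _ A mA; rewrite setTI; exact: cylinder_preim. Qed.

(** By independence the joint law of [Y] and [Y'] is the product of their laws; Tonelli for absolute
    values gives integrability of the product, then Fubini its integral. *)
Lemma indep_expectation (F G : set I) (Y Y' : Omega -> R) :
  F `&` G = set0 ->
  measurable_fun setT (Y : cyl_type F -> R) ->
  measurable_fun setT (Y' : cyl_type G -> R) ->
  P.-integrable setT (EFin \o Y) -> P.-integrable setT (EFin \o Y') ->
  P.-integrable setT (EFin \o (Y \* Y')) /\
  (\int[P]_w (Y w * Y' w)%:E = \int[P]_w (Y w)%:E * \int[P]_w (Y' w)%:E)%E.
Proof.
move=> FG0 mYF mYG iY iY'.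
have mY := cyl_type_measurable mYF; have mY' := cyl_type_measurable mYG.
pose hY : {mfun Omega >-> R} := HB.pack Y (isMeasurableFun.Build _ _ _ _ Y mY).
pose hY' : {mfun Omega >-> R} := HB.pack Y' (isMeasurableFun.Build _ _ _ _ Y' mY').
pose Q w := (Y w, Y' w).
have mQ : measurable_fun setT Q by exact/measurable_fun_pair.
pose hQ : {mfun Omega >-> (R * R)%type} :=
  HB.pack Q (isMeasurableFun.Build _ _ _ _ Q mQ).
pose dY := distribution P hY; pose dY' := distribution P hY'.
have dE : forall A, measurable A -> (dY \x dY')%E A = distribution P hQ A.
  apply: product_measure_unique => A B mA mB.
  rewrite /dY /dY' /= /distribution /pushforward /=.
  rewrite -(indep_sigma_cylinders FG0) //.
  - by have := mYF measurableT A mA; rewrite setTI.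
  - by have := mYG measurableT B mB; rewrite setTI.
pose f (z : R * R) := (z.1 * z.2)%:E.
have mf : measurable_fun [set: (R * R)%type] f.
  by apply/measurable_EFinP; apply: measurable_funM.
have absYdY (U : {mfun Omega >-> R}) :
    (\int[distribution P U]_x `|x%:E| = \int[P]_w `|(U w)%:E|)%E.
  by rewrite ge0_integral_distribution//; exact: measurableT_comp.
have EYdY (U : {mfun Omega >-> R}) : P.-integrable setT (EFin \o U) ->
    (\int[distribution P U]_x x%:E = \int[P]_w (U w)%:E)%E.
  by move=> iU; rewrite integral_distribution//; exact/measurable_EFinP.
have fin U : P.-integrable setT (EFin \o U) -> (\int[P]_w `|(U w)%:E| \is a fin_num)%E.
  by move=> /integrableP[_ h]; rewrite ge0_fin_numE// integral_ge0.
have idY (U : {mfun Omega >-> R}) : P.-integrable setT (EFin \o U) ->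
    (distribution P U).-integrable setT (EFin : R -> \bar R).
  move=> iU; apply/integrableP; split; first exact/measurable_EFinP.
  by rewrite absYdY; have /integrableP[] := iU.
have iff : (dY \x dY')%E.-integrable setT f.
  apply/integrable12ltyP => //.
  rewrite [X in (X < _)%E](_ : _ = \int[dY]_x (`|x%:E| * \int[P]_w `|(Y' w)%:E|))%E.
    rewrite ge0_integralZr//; last exact: integral_ge0.
      rewrite (absYdY hY) -ge0_fin_numE ?fin_numM ?fin//.
      by rewrite mule_ge0 ?integral_ge0.
    exact: measurableT_comp.
  apply: eq_integral => x _ /=; rewrite -(absYdY hY') -ge0_integralZl//.
    by apply: eq_integral => y _; rewrite /f /= normrM EFinM.
  exact: measurableT_comp.
have iQ : P.-integrable setT (f \o Q).
  apply/integrableP; split; first by apply: measurableT_comp.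
  have /integrableP[_] := iff; apply: le_lt_trans.
  rewrite (eq_measure_integral (distribution P hQ))//.
    by rewrite ge0_integral_distribution//; exact: measurableT_comp.
  by move=> A mA _; exact: dE.
split => //.
transitivity (\int[distribution P hQ]_z f z)%E.
  by rewrite integral_distribution.
rewrite -(eq_measure_integral (distribution P hQ) (m1 := (dY \x dY')%E)); last first.
  by move=> A mA _; exact: dE.
rewrite -integral12_prod_meas1// /fubini_F.
under eq_integral => x _.
  rewrite /f /=; under eq_integral do rewrite EFinM.
  rewrite integralZl//; last exact: idY.
  rewrite EYdY//.
  over.
have finY' : (\int[P]_w (Y' w)%:E)%E \is a fin_num by exact: integrable_fin_num.
by rewrite -(fineK finY') integralZr ?fineK ?EYdY//; exact: idY.
Qed.

End independence.

(** * Galton-Watson offspring fields *)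

(* A field [e] gives every label its number of children, whether or not the label
   belongs to the tree, so that the fields below distinct children of the root are
   independent of each other and of [e [::]]. *)
Definition env :=
  g_sigma_algebraType (cylinders (fun u (e : vertex -> nat) => e u) setT).

Definition shiftv (E : Type) (v : vertex) (e : vertex -> E) : vertex -> E :=
  fun u => e (v ++ u).

Definition subtree (v : vertex) : set vertex := [set u | prefix v u].

Lemma subtree_disjoint (i j : nat) : i != j ->
  subtree [:: i] `&` subtree [:: j] = set0.
Proof.
move=> ij; apply/seteqP; split => // -[|k u] [] //=; rewrite /subtree /=.
by move=> /andP[/eqP <- _] /andP[/eqP ji _]; rewrite ji eqxx in ij.
Qed.

Lemma subtree_root (i : nat) : [set [::]] `&` subtree [:: i] = set0.
Proof. by apply/seteqP; split => // u /= [->]. Qed.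

Definition env_cyl (F : set vertex) := cyl_type (fun u (e : env) => e u) F.

Lemma measurable_to_env d (T : measurableType d) (f : T -> env) :
  (forall u, measurable_fun setT (fun x => f x u)) -> measurable_fun setT f.
Proof.
move=> mf; apply: (@measurability _ _ T env setT f
  (cylinders (fun u (e : vertex -> nat) => e u) setT)) => //.
move=> _ [_ [K [S [_ mS ->]]] <-]; rewrite setTI.
rewrite preimage_bigcap; apply: fin_bigcap_measurable => // u _.
by have := mf u measurableT _ (mS u); rewrite setTI.
Qed.

Lemma measurable_coord (F : set vertex) u : F u ->
  measurable_fun setT (fun e : env_cyl F => (e : vertex -> nat) u).
Proof. by move=> Fu; exact: coord_cyl_type. Qed.

Lemma measurable_env (u : vertex) : measurable_fun setT (fun e : env => e u).
Proof. exact: (@measurable_coord setT). Qed.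

Lemma measurable_shift_cyl (F : set vertex) v : subtree v `<=` F ->
  measurable_fun setT (shiftv v : env_cyl F -> env).
Proof.
move=> vF; apply: measurable_to_env => u; apply: measurable_coord.
by apply: vF; rewrite /subtree/= prefix_prefix.
Qed.

Lemma measurable_shift v : measurable_fun setT (shiftv v : env -> env).
Proof. exact: (@measurable_shift_cyl setT). Qed.

Section gw_law.
Context (R : realType) (G : probability env R).

Definition gw_law := mutually_independent G (fun u (e : env) => e u) /\
  forall u (A : set nat), G [set e : env | A (e u)] = G [set e : env | A (e [::])].

Hypothesis GW : gw_law.

(** Both sides are measures in [A]. On a cylinder the shift relabels the coordinates injectively,
    and these are i.i.d. *)
Lemma gw_shift v (A : set env) : measurable A -> G (shiftv v @^-1` A) = G A.
Proof.
move=> mA.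
pose s : {mfun env >-> env} := HB.pack (shiftv v : env -> env)
  (isMeasurableFun.Build _ _ _ _ (shiftv v : env -> env) (@measurable_shift v)).
pose m1 : {measure set env -> \bar R} := distribution G s.
pose m2 : {measure set env -> \bar R} := G.
change (m1 A = m2 A); move: A mA.
apply: (@measure_unique _ R env
  (cylinders (fun u (e : vertex -> nat) => e u) setT) (fun=> setT)) => //.
- exact: (@cylinders_setI _ _ env).
- by move=> _; exact: (@cylinders_setT _ _ env).
- by rewrite bigcup_const.
- move=> _ [K [S [_ mS ->]]].
  transitivity (\prod_(u <- enum_fset K) G [set e : env | S u (e u)])%E;
    last exact/esym/(GW.1 K S mS).
  rewrite [LHS]/(G (shiftv v @^-1` _))
    (_ : _ @^-1` _ = \bigcap_(u in [set` [fset v ++ u | u in K]%fset])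
     [set e : env | S (drop (size v) u) (e u)]); last first.
    apply/seteqP; split => e /= h.
      by move=> _ /imfsetP[u uK ->] /=; rewrite drop_size_cat//; exact: h.
    move=> u uK /=; have := h (v ++ u); rewrite drop_size_cat//; apply => /=.
    by apply/imfsetP; exists u.
  apply: (etrans (GW.1 _ (fun u => S (drop (size v) u)) (fun i => mS _))).
  rewrite big_imfset/=; last by move=> x y _ _ /eqP; rewrite eqseq_cat// eqxx/= => /eqP.
  apply: eq_big_seq => u uK /=; rewrite drop_size_cat//.
  exact: etrans (GW.2 _ (S u)) (esym (GW.2 _ (S u))).
- by move=> k; rewrite /m1 -ge0_fin_numE//; exact: fin_num_measure.
Qed.

Lemma ge0_integral_shift v (f : env -> \bar R) : measurable_fun setT f ->
  (forall e, (0 <= f e)%E) ->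
  (\int[G]_e f (shiftv v e) = \int[G]_e f e)%E.
Proof.
move=> mf f0.
pose s : {mfun env >-> env} := HB.pack (shiftv v : env -> env)
  (isMeasurableFun.Build _ _ _ _ (shiftv v : env -> env) (@measurable_shift v)).
rewrite [RHS](eq_measure_integral (distribution G s)); last first.
  by move=> A mA _; apply: esym; exact: gw_shift.
by rewrite ge0_integral_distribution.
Qed.

Lemma integrable_shift v (f : env -> R) :
  G.-integrable setT (EFin \o f) -> G.-integrable setT (EFin \o (f \o shiftv v)).
Proof.
move=> /integrableP[mf fi]; apply/integrableP; split.
  by apply: (measurableT_comp mf); exact: measurable_shift.
rewrite (ge0_integral_shift v (f := fun e => `|(f e)%:E|)%E)//.
exact: measurableT_comp.
Qed.

Lemma integral_shift v (f : env -> R) : G.-integrable setT (EFin \o f) ->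
  (\int[G]_e (f (shiftv v e))%:E = \int[G]_e (f e)%:E)%E.
Proof.
move=> fi; have mf := measurable_int _ fi.
pose s : {mfun env >-> env} := HB.pack (shiftv v : env -> env)
  (isMeasurableFun.Build _ _ _ _ (shiftv v : env -> env) (@measurable_shift v)).
rewrite [RHS](eq_measure_integral (distribution G s)); last first.
  by move=> A mA _; apply: esym; exact: gw_shift.
rewrite integral_distribution//.
exact: (integrable_shift v fi).
Qed.

(** Each shift pulls the exceptional null set back to a null set, and the labels are countable;
    [pickle] enumerates them. *)
Lemma ae_shift (Pr : env -> Prop) : {ae G, forall e, Pr e} ->
  {ae G, forall e, forall v, Pr (shiftv v e)}.
Proof.
move=> [A [mA A0 PA]].
pose Pn (n : nat) (e : env) : Prop :=
  forall v : vertex, choice.pickle v = n -> Pr (shiftv v e).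
have h (n : nat) : {ae G, forall e, Pn n e}.
  have [[v vn]|nov] := pselect (exists v : vertex, choice.pickle v = n); last first.
    by apply: aeW => e v vn; case: nov; exists v.
  exists (shiftv v @^-1` A); split.
  - by have := @measurable_shift v measurableT _ mA; rewrite setTI.
  - exact: etrans (gw_shift v mA) A0.
  - move=> e /= nPn; apply: PA => /= Prv; apply: nPn => u un.
    by rewrite (pcan_inj choice.pickleK (etrans un (esym vn))).
have := ae_foralln h; apply: filterS => e + v; exact.
Qed.

End gw_law.

(** * Moments of sums over the children of the root *)

Section means.
Context d (T : measurableType d) (R : realType) (P : probability T R).
Implicit Types (D : set T) (f g : T -> R) (a b : R).

(** Integrability and a real value of the integral are kept together, so that moments can be
    computed in [R]. For a proper subset [D] the integral is not normalized by [P D]. *)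
Definition has_mean D f a := P.-integrable D (EFin \o f) /\
  (\int[P]_(x in D) (f x)%:E = a%:E)%E.

Lemma mean_unique D f a b : has_mean D f a -> has_mean D f b -> a = b.
Proof. by move=> [_ fa] [_]; rewrite fa => -[]. Qed.

Lemma mean_eq D f g a : measurable D -> (forall x, D x -> f x = g x) ->
  has_mean D f a -> has_mean D g a.
Proof.
move=> mD fg [If fa]; split.
  by apply: eq_integrable If => // x; rewrite inE => Dx /=; rewrite fg.
rewrite -fa; apply: eq_integral => x; rewrite inE => Dx.
by rewrite fg.
Qed.

Lemma mean_cst D a : measurable D -> has_mean D (fun=> a) (fine (P D) * a).
Proof.
move=> mD; split; first exact: finite_measure_integrable_cst.
rewrite (integral_cst _ mD a%:E) muleC EFinM fineK//.
exact: fin_num_measure.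
Qed.

Lemma mean_indic D : measurable D -> has_mean setT (\1_D : T -> R) (fine (P D)).
Proof.
move=> mD; split; first exact: integrable_indic.
by rewrite integral_indic// setIT fineK//; exact: fin_num_measure.
Qed.

Lemma mean_cstT a : has_mean setT (fun=> a) a.
Proof.
by have := @mean_cst setT a measurableT; rewrite probability_setT mul1r.
Qed.

Lemma mean_integrable D f : measurable D -> P.-integrable D (EFin \o f) ->
  exists a, has_mean D f a.
Proof.
move=> mD If; exists (fine (\int[P]_(x in D) (f x)%:E)); split => //.
by rewrite fineK//; exact: integrable_fin_num.
Qed.

Lemma mean_scale D f a b : measurable D -> has_mean D f a ->
  has_mean D (fun x => b * f x) (b * a).
Proof.
move=> mD [If fa]; split; first exact: (integrableZl mD b If).
by under eq_integral do rewrite EFinM; rewrite integralZl// fa.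
Qed.

Lemma mean_add D f g a b : measurable D -> has_mean D f a -> has_mean D g b ->
  has_mean D (fun x => f x + g x) (a + b).
Proof.
move=> mD [If fa] [Ig gb]; split; first exact: (integrableD mD If Ig).
by under eq_integral do rewrite EFinD; rewrite integralD// fa gb.
Qed.

Lemma mean_sub D f g a b : measurable D -> has_mean D f a -> has_mean D g b ->
  has_mean D (fun x => f x - g x) (a - b).
Proof.
move=> mD fa gb; have := mean_add mD fa (mean_scale (-1) mD gb).
rewrite mulN1r; apply: mean_eq => // x _; by rewrite mulN1r.
Qed.

Lemma mean_sum D (I : Type) (s : seq I) (p : pred I) (f : I -> T -> R) (a : I -> R) :
  measurable D -> (forall i, p i -> has_mean D (f i) (a i)) ->
  has_mean D (fun x => \sum_(i <- s | p i) f i x) (\sum_(i <- s | p i) a i).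
Proof.
move=> mD fa; elim: s => [|i s IH].
  have := @mean_cst D 0 mD; rewrite mulr0 big_nil.
  by apply: mean_eq => // x _; rewrite big_nil.
have [pi|pi] := boolP (p i); last first.
  by rewrite big_cons (negbTE pi); apply: mean_eq IH => // x _;
    rewrite big_cons (negbTE pi).
rewrite big_cons pi; apply: mean_eq (mean_add mD (fa i pi) IH) => // x _.
by rewrite big_cons pi.
Qed.

Lemma mean_measurable f a : has_mean setT f a -> measurable_fun setT f.
Proof. by move=> [/measurable_int/measurable_EFinP]. Qed.

Lemma mean_ge0 D f a : measurable D -> (forall x, D x -> 0 <= f x) ->
  has_mean D f a -> 0 <= a.
Proof.
move=> mD f0 [_ fa]; rewrite -lee_fin -fa; apply: integral_ge0 => x Dx.
by rewrite lee_fin f0.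
Qed.

Lemma mean_mono D f g a b : measurable D -> (forall x, D x -> f x <= g x) ->
  has_mean D f a -> has_mean D g b -> a <= b.
Proof.
move=> mD fg fa gb; rewrite -subr_ge0.
by apply: (mean_ge0 mD _ (mean_sub mD gb fa)) => x /fg; rewrite subr_ge0.
Qed.

Lemma mean_dominated f g b : measurable_fun setT f ->
  (forall x, `|f x| <= g x) -> has_mean setT g b ->
  exists a, has_mean setT f a.
Proof.
move=> mf fg [Ig _]; apply: mean_integrable => //.
apply: le_integrable Ig => //; first exact/measurable_EFinP.
by move=> x _ /=; rewrite lee_fin (le_trans (fg x))// ler_norm.
Qed.

Lemma mean_dominated_le f g b : measurable_fun setT f ->
  (forall x, 0 <= f x <= g x) -> has_mean setT g b ->
  exists2 a, 0 <= a <= b & has_mean setT f a.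
Proof.
move=> mf fg gb.
have [x|a fa] := mean_dominated mf _ gb.
  by have /andP[f0 fgx] := fg x; rewrite ger0_norm.
exists a => //; apply/andP; split.
  by apply: (mean_ge0 measurableT _ fa) => x _; have /andP[] := fg x.
by apply: (mean_mono measurableT _ fa gb) => x _; have /andP[] := fg x.
Qed.

End means.

(** * Conditioning on the number of children of the root *)

Section branching.
Context (R : realType) (G : probability env R).
Hypothesis GW : gw_law G.
Implicit Types (f g : env -> R) (z i j : nat).

Definition root_count z : set env := [set e : env | e [::] = z].

Definition rootp z : R := fine (G (root_count z)).

Lemma measurable_root_count z : measurable (root_count z).
Proof.
by have := measurable_env [::] measurableT (I : measurable [set z]); rewrite setTI.
Qed.

Lemma rootp_ge0 z : 0 <= rootp z.
Proof. by rewrite fine_ge0. Qed.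

Lemma indep_mean (F F' : set vertex) f g a b : F `&` F' = set0 ->
  measurable_fun setT (f : env_cyl F -> R) ->
  measurable_fun setT (g : env_cyl F' -> R) ->
  has_mean G setT f a -> has_mean G setT g b ->
  has_mean G setT (fun e => f e * g e) (a * b).
Proof.
move=> FF' mf mg [If fa] [Ig gb].
have [] := indep_expectation (X := fun u (e : env) => e u) (@measurable_env)
  GW.1 FF' mf mg If Ig.
by move=> Ifg; rewrite fa gb => fgE; split.
Qed.

Lemma mean_shift v f a : has_mean G setT f a ->
  has_mean G setT (fun e => f (shiftv v e)) a.
Proof.
move=> [If fa]; split; first exact: (integrable_shift GW v If).
by rewrite (integral_shift GW v If).
Qed.

Lemma mean_restrict z f a :
  has_mean G setT (fun e => \1_(root_count z) e * f e) a ->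
  has_mean G (root_count z) f a.
Proof.
have mz := measurable_root_count z.
have E : (EFin \o (fun e => \1_(root_count z) e * f e)) = (EFin \o f) \_ (root_count z).
  apply/funext => e; rewrite /= patchE indicE.
  by case: (e \in root_count z); rewrite ?mul1r ?mul0r.
move=> [If fa]; split; first by apply/integrable_mkcond; rewrite // -E.
by rewrite integral_mkcond -fa; apply: eq_integral => e _; rewrite -E.
Qed.

Lemma mean_root z : has_mean G setT (\1_(root_count z) : env -> R) (rootp z).
Proof. by apply: mean_indic; exact: measurable_root_count. Qed.

Lemma measurable_root_cyl z :
  measurable_fun setT (\1_(root_count z) : env_cyl [set [::]] -> R).
Proof.
apply: measurable_indic; have := measurable_coord (erefl : [set [::]] [::]).
by move=> /(_ measurableT _ (I : measurable [set z])); rewrite setTI.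
Qed.

Lemma mean_root_indep (F : set vertex) f a z : [set [::]] `&` F = set0 ->
  measurable_fun setT (f : env_cyl F -> R) -> has_mean G setT f a ->
  has_mean G (root_count z) f (rootp z * a).
Proof.
move=> F0 mf fa; apply: mean_restrict.
by apply: (indep_mean F0) => //; [exact: measurable_root_cyl|exact: mean_root].
Qed.

Lemma measurable_shift_comp (F : set vertex) v f : subtree v `<=` F ->
  measurable_fun setT f ->
  measurable_fun setT (fun e : env_cyl F => f (shiftv v e)).
Proof.
by move=> vF mf; apply: (measurableT_comp mf); exact: measurable_shift_cyl.
Qed.

Lemma mean_child z i f a : has_mean G setT f a ->
  has_mean G (root_count z) (fun e => f (shiftv [:: i] e)) (rootp z * a).
Proof.
move=> fa; apply: (mean_root_indep (F := subtree [:: i])).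
- exact: subtree_root.
- by apply: measurable_shift_comp => //; exact: mean_measurable fa.
- exact: mean_shift.
Qed.

(** The root label and the label sets below [i] and below [j] are pairwise disjoint, so the root
    count and the two factors are independent. *)
Lemma mean_children z i j f g a b : i != j ->
  has_mean G setT f a -> has_mean G setT g b ->
  has_mean G (root_count z) (fun e => f (shiftv [:: i] e) * g (shiftv [:: j] e))
    (rootp z * (a * b)).
Proof.
move=> ij fa gb; apply: (mean_root_indep (F := subtree [:: i] `|` subtree [:: j])).
- by rewrite setIUr !subtree_root setU0.
- apply: measurable_funM; apply: measurable_shift_comp.
  + by move=> u; left.
  + exact: mean_measurable fa.
  + by move=> u; right.
  + exact: mean_measurable gb.
- apply: (indep_mean (subtree_disjoint ij)).
  + by apply: measurable_shift_comp => //; exact: mean_measurable fa.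
  + by apply: measurable_shift_comp => //; exact: mean_measurable gb.
  + exact: mean_shift.
  + exact: mean_shift.
Qed.

Lemma root_count_trivIset : trivIset setT root_count.
Proof.
by apply/trivIsetP => i j _ _ /eqP ij; apply/seteqP; split => // e [ei ej];
  case: ij; exact: etrans (esym ei) ej.
Qed.

Lemma bigcup_root_count : \bigcup_z root_count z = setT.
Proof. by apply/seteqP; split => // e _; exists (e [::]). Qed.

(** The integral is split over the countably many values of the root count, and the bounds sum to
    the integral of [h] at the root count. Integrability of [f] is a conclusion here. *)
Lemma mean_count_le (f : env -> R) (h : nat -> R) (r : R) :
  measurable_fun setT f -> (forall e, 0 <= f e) ->
  (forall z, exists2 a, a <= rootp z * h z & has_mean G (root_count z) f a) ->
  has_mean G setT (fun e => h (e [::])) r ->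
  exists2 a, 0 <= a <= r & has_mean G setT f a.
Proof.
move=> mf f0 fh [Ih hr].
have mhN : measurable_fun setT (fun e : env => h (e [::])).
  by have /measurable_int/measurable_EFinP := Ih.
have h0 z : 0 <= h z \/ rootp z = 0.
  have [a az fa] := fh z.
  have a0 : 0 <= a by apply: (mean_ge0 (measurable_root_count z) _ fa).
  have [->|p0] := eqVneq (rootp z) 0; [by right|left].
  by rewrite -(@pmulr_rge0 _ (rootp z)) ?lt0r ?p0 ?rootp_ge0// (le_trans _ az)// a0.
have intf : (\int[G]_e (f e)%:E <= r%:E)%E.
  rewrite -hr -bigcup_root_count ge0_integral_bigcup//; last 4 first.
  - exact: measurable_root_count.
  - by rewrite bigcup_root_count; exact/measurable_EFinP.
  - by move=> e _; rewrite lee_fin.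
  - exact: root_count_trivIset.
  rewrite integral_bigcup//; last 3 first.
  - exact: root_count_trivIset.
  - exact: measurable_root_count.
  - by rewrite bigcup_root_count.
  apply: lee_nneseries => z _.
    by move=> _; apply: integral_ge0 => e _; rewrite lee_fin.
  have [a az [_ ->]] := fh z.
  have [_ ->] : has_mean G (root_count z) (fun e => h (e [::])) (rootp z * h z).
    have mz := measurable_root_count z.
    by apply: (mean_eq mz _ (mean_cst G (h z) mz)) => e ez; congr (h _); exact: esym.
  by rewrite lee_fin.
have If : G.-integrable setT (EFin \o f).
  apply/integrableP; split; first exact/measurable_EFinP.
  under eq_integral do rewrite /= ger0_norm//.
  by rewrite (le_lt_trans intf)// ltry.
have [a fa] := mean_integrable measurableT If.
exists a => //; rewrite -!lee_fin -(proj2 fa) intf andbT.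
by apply: integral_ge0 => e _; rewrite lee_fin.
Qed.

Lemma mean_count (f : env -> R) (h : nat -> R) (r : R) :
  measurable_fun setT f -> (forall e, 0 <= f e) ->
  (forall z, has_mean G (root_count z) f (rootp z * h z)) ->
  has_mean G setT (fun e => h (e [::])) r ->
  has_mean G setT f r.
Proof.
move=> mf f0 fh hr.
have [z|a _ fa] := mean_count_le mf f0 _ hr.
  by exists (rootp z * h z).
split; first exact: fa.1.
rewrite -hr.2 -bigcup_root_count !integral_bigcup ?bigcup_root_count//; first last.
- exact: fa.1.
- exact: measurable_root_count.
- exact: root_count_trivIset.
- exact: hr.1.
- exact: measurable_root_count.
- exact: root_count_trivIset.
apply: eq_eseriesr => z _; rewrite (fh z).2.
have mz := measurable_root_count z; symmetry.
have [] // : has_mean G (root_count z) (fun e => h (e [::])) (rootp z * h z).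
by apply: (mean_eq mz _ (mean_cst G (h z) mz)) => e ez; congr (h _); exact: esym.
Qed.

(** Splitting by the value of the root count replaces the random range of a sum or product by a
    fixed one. *)
Lemma measurable_count (F : nat -> env -> R) :
  (forall z, measurable_fun setT (F z)) ->
  measurable_fun setT (fun e : env => F (e [::]) e).
Proof.
move=> mF _ Y mY; rewrite setTI.
rewrite (_ : _ @^-1` _ = \bigcup_z (root_count z `&` (F z @^-1` Y))); last first.
  apply/seteqP; split => e /=; first by move=> Ye; exists (e [::]).
  by move=> [z _ [ez]] /=; rewrite -ez.
apply: bigcup_measurable => z _; apply: measurableI.
  exact: measurable_root_count.
by have := mF z measurableT _ mY; rewrite setTI.
Qed.

Definition csum (f : env -> R) (e : env) : R :=
  \sum_(i < e [::]) f (shiftv [:: val i] e).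

Lemma measurable_child (f : env -> R) i : measurable_fun setT f ->
  measurable_fun setT (fun e : env => f (shiftv [:: i] e)).
Proof. by move=> mf; apply: (measurableT_comp mf); exact: measurable_shift. Qed.

Lemma measurable_csum f : measurable_fun setT f -> measurable_fun setT (csum f).
Proof.
move=> mf; apply: (@measurable_count
  (fun z (e : env) => \sum_(i < z) f (shiftv [:: val i] e))) => z.
by apply: measurable_sum => i; exact: measurable_child.
Qed.

Lemma csum_ge0 f e : (forall x, 0 <= f x) -> 0 <= csum f e.
Proof. by move=> f0; apply: sumr_ge0. Qed.

Lemma mean_csum_root z f a : has_mean G setT f a ->
  has_mean G (root_count z) (csum f) (rootp z * (z%:R * a)).
Proof.
move=> fa; have mz := measurable_root_count z.
have := mean_sum (index_enum 'I_z) (p := xpredT) mz (fun (i : 'I_z) _ => mean_child z (val i) fa).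
have -> : rootp z * (z%:R * a) = \sum_(i < z) rootp z * a.
  by rewrite sumr_const card_ord -[RHS]mulr_natl mulrCA.
by apply: mean_eq => // e <-.
Qed.

Lemma sum_diag (z : nat) (a b : R) :
  \sum_(i < z) \sum_(j < z) (if i == j then a else b) =
  z%:R * a + (z%:R ^+ 2 - z%:R) * b.
Proof.
transitivity (\sum_(i < z) (a + (z%:R - 1) * b)).
  apply: eq_bigr => i _; rewrite (bigD1 i)//= eqxx; congr (_ + _).
  rewrite (eq_bigr (fun=> b)) => [|j ji]; last by rewrite eq_sym (negbTE ji).
  rewrite sumr_const cardC1 card_ord -mulr_natl.
  by case: z i => [[]//|z i]; rewrite /= mulrSr; ring.
rewrite sumr_const card_ord -mulr_natl; ring.
Qed.

(** The [z] diagonal terms contribute [b] each; the others are products of independent copies and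
    contribute [a ^+ 2] each. *)
Lemma mean_csum_sqr_root z f a b : has_mean G setT f a ->
  has_mean G setT (fun e => f e ^+ 2) b ->
  has_mean G (root_count z) (fun e => csum f e ^+ 2)
    (rootp z * (z%:R * b + (z%:R ^+ 2 - z%:R) * a ^+ 2)).
Proof.
move=> fa fb; have mz := measurable_root_count z.
have H (i j : 'I_z) : has_mean G (root_count z)
    (fun e => f (shiftv [:: val i] e) * f (shiftv [:: val j] e))
    (rootp z * (if i == j then b else a ^+ 2)).
  have [->|ij] := eqVneq i j; last by rewrite expr2; exact: mean_children.
  by apply: (mean_eq mz _ (mean_child z j fb)).
have := mean_sum (index_enum 'I_z) (p := xpredT) mz (fun (i : 'I_z) _ =>
  mean_sum (index_enum 'I_z) (p := xpredT) mz (fun (j : 'I_z) _ => H i j)).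
under eq_bigr do rewrite -mulr_sumr; rewrite -mulr_sumr sum_diag.
apply: mean_eq => // e <-; rewrite expr2 /csum mulr_suml.
by apply: eq_bigr => i _; rewrite mulr_sumr.
Qed.

End branching.

Lemma sqr_sum_le (R : realType) (n : nat) (y : 'I_n -> R) :
  (\sum_(i < n) y i) ^+ 2 <= n%:R * \sum_(i < n) y i ^+ 2.
Proof.
elim: n y => [|n IH] y; first by rewrite !big_ord0 mul0r expr0n.
rewrite !big_ord_recr /=.
set S := \sum_(i < n) _; set Q := \sum_(i < n) _; set t := y ord_max.
(* This is the sum of the squares of [y i - t], exactly the slack of the induction step. *)
have h : 0 <= Q - 2 * S * t + n%:R * t ^+ 2.
  rewrite (_ : _ + _ = \sum_(i < n) (y (widen_ord (leqnSn n) i) - t) ^+ 2).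
    by apply: sumr_ge0 => i _; exact: sqr_ge0.
  have -> : Q - 2 * S * t + n%:R * t ^+ 2 = \sum_(i < n)
      (y (widen_ord (leqnSn n) i) ^+ 2 - 2 * y (widen_ord (leqnSn n) i) * t + t ^+ 2).
    by rewrite big_split sumrB/= sumr_const card_ord -[t ^+ 2 *+ n]mulr_natl
      -mulr_suml -mulr_sumr.
  by apply: eq_bigr => i _; ring.
have := IH (fun i => y (widen_ord (leqnSn n) i)); rewrite -/S -/Q => SQ.
rewrite -natr1; nra.
Qed.

(** * Moments of sums over a random number of children *)

Section branching_moments.
Context (R : realType) (G : probability env R).
Hypothesis GW : gw_law G.
Variables mu m2 m4 : R.
Hypothesis mean1 : has_mean G setT (fun e : env => (e [::])%:R) mu.
Hypothesis mean2 : has_mean G setT (fun e : env => (e [::])%:R ^+ 2) m2.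
Hypothesis mean4 : has_mean G setT (fun e : env => (e [::])%:R ^+ 4) m4.
Implicit Types (f g : env -> R).

(* The sum of [f x * f y] over the ordered pairs of distinct children, see [psumE]. *)
Definition psum f (e : env) : R := csum f e ^+ 2 - csum (fun x => f x ^+ 2) e.

Lemma mean_csum f a : (forall e, 0 <= f e) -> has_mean G setT f a ->
  has_mean G setT (csum f) (mu * a).
Proof.
move=> f0 fa; apply: (mean_count (h := fun z => z%:R * a)).
- by apply: measurable_csum; exact: mean_measurable fa.
- by move=> e; exact: csum_ge0.
- by move=> z; exact: mean_csum_root.
- rewrite mulrC; apply: (mean_eq measurableT _ (mean_scale a measurableT mean1)) => e _.
  by rewrite mulrC.
Qed.

(** [m2 - mu] is E Z(Z-1), the mean number of ordered pairs of distinct children. For centred [f]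
    only the first term survives, which is the source of the contractions below. *)
Lemma mean_csum_sqr f a b : has_mean G setT f a ->
  has_mean G setT (fun e => f e ^+ 2) b ->
  has_mean G setT (fun e => csum f e ^+ 2) (mu * b + (m2 - mu) * a ^+ 2).
Proof.
move=> fa fb.
apply: (mean_count (h := fun z => z%:R * b + (z%:R ^+ 2 - z%:R) * a ^+ 2)).
- by apply: measurable_funX; apply: measurable_csum; exact: mean_measurable fa.
- by move=> e; exact: sqr_ge0.
- by move=> z; exact: mean_csum_sqr_root.
- have h1 := mean_scale b measurableT mean1.
  have h2 := mean_scale (a ^+ 2) measurableT (mean_sub measurableT mean2 mean1).
  have := mean_add measurableT h1 h2.
  rewrite mulrC [_ * (m2 - mu)]mulrC; apply: mean_eq => // e _.
  by rewrite mulrC [X in _ + X]mulrC.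
Qed.

Lemma mean_psum f a b : (forall e, 0 <= f e) -> has_mean G setT f a ->
  has_mean G setT (fun e => f e ^+ 2) b ->
  has_mean G setT (psum f) ((m2 - mu) * a ^+ 2).
Proof.
move=> f0 fa fb.
have h := mean_csum (fun e => sqr_ge0 (f e)) fb.
have := mean_sub measurableT (mean_csum_sqr fa fb) h.
by rewrite [X in X - _]addrC addrK.
Qed.

Lemma psumE f e : psum f e = \sum_(i < e [::]) \sum_(j < e [::])
  (if i == j then 0 else f (shiftv [:: val i] e) * f (shiftv [:: val j] e)).
Proof.
rewrite /psum expr2 /csum mulr_suml -sumrB; apply: eq_bigr => i _.
rewrite mulr_sumr (bigD1 i)//= [RHS](bigD1 i)//= eqxx add0r -expr2 addrAC subrr add0r.
by apply: eq_bigr => j ji; rewrite eq_sym (negbTE ji).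
Qed.

Lemma measurable_psum f : measurable_fun setT f -> measurable_fun setT (psum f).
Proof.
move=> mf; apply: measurable_funB.
  by apply: measurable_funX; exact: measurable_csum.
by apply: measurable_csum; exact: measurable_funX.
Qed.

(** Cauchy-Schwarz in each of the two sums of [psumE] bounds the square by Z^2 times the sum of
    [f x ^+ 2 * f y ^+ 2] over distinct children. The two factors are independent, so only the
    second moment of [f] enters, and the Z^2 (Z^2 - Z) terms are paid for by the fourth moment of
    Z. *)
Lemma mean_psum_sqr_le f b : measurable_fun setT f ->
  has_mean G setT (fun e => f e ^+ 2) b ->
  exists2 r, 0 <= r <= m4 * b ^+ 2 &
    has_mean G setT (fun e => psum f e ^+ 2) r.
Proof.
move=> mf fb.
pose gz (z : nat) (e : env) : R := z%:R * \sum_(i < z) (z%:R * \sum_(j < z)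
  (if i == j then 0 else f (shiftv [:: val i] e) ^+ 2 * f (shiftv [:: val j] e) ^+ 2)).
have mgz z : measurable_fun setT (gz z).
  apply: measurable_funM => //; apply: measurable_sum => i.
  apply: measurable_funM => //; apply: measurable_sum => j.
  case: (i == j) => //.
  by apply: measurable_funM; apply: measurable_funX; exact: measurable_child.
pose g (e : env) := gz (e [::]) e.
have g0 e : 0 <= g e.
  apply: mulr_ge0 => //; apply: sumr_ge0 => i _; apply: mulr_ge0 => //.
  apply: sumr_ge0 => j _; case: ifP => // _; apply: mulr_ge0; exact: sqr_ge0.
have b0 : 0 <= b.
  by apply: (mean_ge0 measurableT _ fb) => e _; exact: sqr_ge0.
have [r rb gr] : exists2 r, 0 <= r <= m4 * b ^+ 2 & has_mean G setT g r.
  apply: (mean_count_le (h := fun z => z%:R ^+ 4 * b ^+ 2) (measurable_count mgz) g0).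
  - move=> z; have mz := measurable_root_count z.
  exists (z%:R * \sum_(i < z) (z%:R * \sum_(j < z)
    (if i == j then 0 else rootp G z * (b * b)))).
    rewrite -mulr_sumr sum_diag mulr0 add0r.
    have -> : z%:R * (z%:R * ((z%:R ^+ 2 - z%:R) * (rootp G z * (b * b)))) =
      rootp G z * (z%:R ^+ 4 * b ^+ 2) - rootp G z * z%:R ^+ 3 * b ^+ 2 :> R by ring.
    rewrite gerBl; apply: mulr_ge0; last exact: sqr_ge0.
    by apply: mulr_ge0; [exact: rootp_ge0|exact: exprn_ge0].
  apply: (mean_eq mz (f := gz z)); first by move=> e <-.
  apply: mean_scale => //; apply: mean_sum => // i _.
  apply: mean_scale => //; apply: mean_sum => // j _.
  have [_|ij] := eqVneq i j.
    by have := mean_cst G 0 mz; rewrite mulr0.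
  exact: (mean_children GW z ij fb fb).
  - rewrite mulrC; apply: (mean_eq measurableT _ (mean_scale (b ^+ 2) measurableT mean4)) => e _.
  by rewrite mulrC.
have [r' r'r fr'] : exists2 r', 0 <= r' <= r & has_mean G setT (fun e => psum f e ^+ 2) r'.
  apply: (mean_dominated_le _ _ gr).
  by apply: measurable_funX; exact: measurable_psum.
move=> e; rewrite sqr_ge0 /= psumE; apply: (le_trans (sqr_sum_le _)).
  rewrite /g /gz ler_wpM2l//; apply: ler_sum => i _.
  apply: (le_trans (sqr_sum_le _)); rewrite ler_wpM2l//; apply: ler_sum => j _.
  by case: ifP; rewrite ?expr0n// exprMn.
exists r' => //; lra.
Qed.

End branching_moments.

(** * Connection probabilities and the martingale limit *)

Section real_sequences.
Context (R : realType).

(** Bonferroni inequalities for independent events of probabilities [y i]. A further factor [1 - t]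
    adds [t * (1 - p)] to [r], where [p] is the product so far; this is nonnegative, and at most
    [t * S] because [r] is nonnegative. Hence the bounds are proved together. *)
Lemma prod_sub_bounds (y : nat -> R) n : (forall i, 0 <= y i <= 1) ->
  let S := \sum_(i < n) y i in let r := S - 1 + \prod_(i < n) (1 - y i) in
  [/\ 0 <= \prod_(i < n) (1 - y i) <= 1, 0 <= r,
      2 * r <= S ^+ 2 - \sum_(i < n) y i ^+ 2 &
      (1 < n)%N -> y 0%N * y 1%N <= r].
Proof.
move=> y01 /=; elim: n => [|n].
  by rewrite !big_ord0 expr0n/= !lexx ler01; split=> //; lra.
rewrite !big_ord_recr /=.
move ES : (\sum_(i < n) y i) => S; move Ep : (\prod_(i < n) (1 - y i)) => p.
move: (\sum_(i < n) y i ^+ 2) => Q.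
move=> [/andP[p0 p1] r0 rQ rn]; have /andP[t0 t1] := y01 n; set t := y n in t0 t1 *.
split.
- by apply/andP; split; nra.
- nra.
- nra.
- case: n @t ES Ep rn t0 t1 => // -[|n] t ES Ep rn t0 t1 _.
    move: ES Ep; rewrite !big_ord1 => <- <-; rewrite /t; nra.
  have := rn isT; nra.
Qed.

(* [b] decays slower than any geometric sequence of ratio [r < 1], so the
   forcing term dominates the recursion. *)
Lemma forced_recursion (b D eps : nat -> R) (r C : R) (k1 : nat) :
  (forall k, 0 < b k) -> (forall k, (1 - eps k) * b k <= b k.+1) ->
  eps @ \oo --> (0 : R) -> 0 <= r < 1 -> 0 <= C ->
  (forall k, (k1 <= k)%N -> D k.+1 <= r * D k + C * b k) ->
  exists K k0, 0 <= K /\ forall k, (k0 <= k)%N -> D k <= K * b k.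
Proof.
move=> b0 bS eps0 /andP[r0 r1] C0 DS.
(* Once [eps k] is below this value, [b] shrinks per step by a factor of at least (3 + r) / 4, which
   exceeds [r]. *)
have d0 : 0 < (1 - r) / 4 by lra.
have [k2 _ hk2] := (cvgrPdist_lt _ _).1 eps0 _ d0.
have ek k : (k2 <= k)%N -> eps k <= (1 - r) / 4.
  move=> /hk2 /=; rewrite sub0r normrN => /ltW; exact: le_trans (ler_norm _).
pose k0 := maxn k1 k2.
(* The first summand starts the induction at [k0]; the second leaves room for [C] between [r * K]
   and [K * (3 + r) / 4]. *)
pose K := `|D k0| / b k0 + 8 * C / (1 - r).
have A0 : 0 <= `|D k0| / b k0 by rewrite divr_ge0// ltW.
have B0 : 0 <= 8 * C / (1 - r) by rewrite divr_ge0//; lra.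
have K0 : 0 <= K by rewrite addr_ge0.
have KC : 8 * C <= K * (1 - r).
  by rewrite -ler_pdivrMr ?subr_gt0// lerDr.
exists K, k0; split => // k /subnK <-; elim: (k - k0)%N => [|j IH].
  rewrite add0n mulrDl divfK ?gt_eqF//.
  by rewrite (le_trans (ler_norm _))// lerDl mulr_ge0// ltW.
rewrite addSn; set n := (j + k0)%N in IH *.
have n1 : (k1 <= n)%N by rewrite /n (leq_trans (leq_maxl k1 k2))// leq_addl.
have n2 : (k2 <= n)%N by rewrite /n (leq_trans (leq_maxr k1 k2))// leq_addl.
apply: (le_trans (DS _ n1)).
have bn := b0 n; have bn1 := b0 n.+1; have := bS n; have := ek _ n2 => e1 e2.
have h1 : (1 - (1 - r) / 4) * b n <= b n.+1.
  by apply: le_trans e2; rewrite ler_pM2r//; lra.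
have h2 : r * D n <= r * (K * b n) by rewrite ler_wpM2l.
apply: (le_trans (lerD h2 (lexx _))).
have h3 : K * ((1 - (1 - r) / 4) * b n) <= K * b n.+1 by rewrite ler_wpM2l.
apply: le_trans h3.
have h4 : 8 * C * b n <= K * (1 - r) * b n by rewrite ler_pM2r.
nra.
Qed.

(** The increments telescope, and [c n] stays positive. *)
Lemma sum_sqr_le (c : nat -> R) (a : R) : 0 < a -> (forall k, 0 < c k) ->
  (forall k, a * c k ^+ 2 <= c k - c k.+1) ->
  forall n, \sum_(k < n) c k ^+ 2 <= c 0%N / a.
Proof.
move=> a0 c0 cS n; rewrite ler_pdivlMr// mulrC mulr_sumr.
have : \sum_(k < n) a * c k ^+ 2 <= c 0%N - c n.
  elim: n => [|n IH]; first by rewrite big_ord0 subrr.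
  rewrite big_ord_recr /=; have := cS n; lra.
have := c0 n; lra.
Qed.

(** The sequence is nonincreasing, so k + 1 times [c k ^+ 2] is at most the bounded sum of squares:
    [c k] is O(k^(-1/2)). *)
Lemma cvg_sum_sqr (c : nat -> R) (a : R) : 0 < a -> (forall k, 0 < c k) ->
  (forall k, a * c k ^+ 2 <= c k - c k.+1) -> c @ \oo --> (0 : R).
Proof.
move=> a0 c0 cS.
have cnd k : c k.+1 <= c k.
  by have := cS k; have := sqr_ge0 (c k); nra.
have cmono j k : (j <= k)%N -> c k <= c j.
  by move=> /subnK <-; elim: (k - j)%N => // i IH; rewrite addSn (le_trans (cnd _)).
have h k : k.+1%:R * c k ^+ 2 <= c 0%N / a.
  apply: le_trans (sum_sqr_le a0 c0 cS k.+1).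
  rewrite mulr_natl -[X in _ *+ X]card_ord -sumr_const.
  apply: ler_sum => i _; rewrite ler_sqr ?nnegrE ?(ltW (c0 _))//.
  by apply: cmono; rewrite -ltnS.
apply/cvgrPdist_lt => e e0.
have := @near_infty_natSinv_lt R (PosNum (divr_gt0 (mulr_gt0 a0 (exprn_gt0 2 e0)) (c0 0%N))).
apply: filterS => k /= hk.
rewrite sub0r normrN gtr0_norm// -(@ltr_pXn2r _ 2%N)// ?nnegrE ?ltW//.
have h1 : c k ^+ 2 <= c 0%N / a * k.+1%:R^-1.
  by rewrite ler_pdivlMr ?ltr0Sn// mulrC; exact: h.
apply: le_lt_trans h1 _.
have h2 : c 0%N / a * k.+1%:R^-1 < c 0%N / a * (a * e ^+ 2 / c 0%N).
  by rewrite ltr_pM2l// divr_gt0.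
apply: (lt_le_trans h2).
rewrite le_eqVlt; apply/orP; left; apply/eqP; field.
by rewrite !gt_eqF.
Qed.

End real_sequences.

(* [surv p k e] is the probability that the root of the tree with offspring field
   [e] is joined to generation [k] in percolation of parameter [p] ([conn_prob]),
   and [gwW p k e] is [p ^+ k] times the size of generation [k] ([gwW_lvl]). *)
Fixpoint surv (R : realType) (p : R) (k : nat) (e : vertex -> nat) : R :=
  if k is k'.+1 then
    1 - \prod_(i < e [::]) (1 - p * surv p k' (shiftv [:: val i] e))
  else 1.

Fixpoint gwW (R : realType) (p : R) (k : nat) (e : vertex -> nat) : R :=
  if k is k'.+1 then p * \sum_(i < e [::]) gwW p k' (shiftv [:: val i] e)
  else 1.

(** * Moments of q_k and W_k, and their comparison in L^2 *)

Section gw_process.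
Context (R : realType) (G : probability env R).
Hypothesis GW : gw_law G.
Variables mu m2 m4 : R.
Hypothesis mean1 : has_mean G setT (fun e : env => (e [::])%:R) mu.
Hypothesis mean2 : has_mean G setT (fun e : env => (e [::])%:R ^+ 2) m2.
Hypothesis mean4 : has_mean G setT (fun e : env => (e [::])%:R ^+ 4) m4.
Hypothesis mu_gt1 : 1 < mu.

Let p : R := mu^-1.

Let p_gt0 : 0 < p.
Proof. by rewrite invr_gt0 (lt_trans ltr01). Qed.

Let p_lt1 : p < 1.
Proof. by rewrite invf_lt1// (lt_trans ltr01). Qed.

Let mup : p * mu = 1.
Proof. by rewrite mulVf// gt_eqF// (lt_trans ltr01). Qed.

Let q k : env -> R := surv p k.
Let W k : env -> R := gwW p k.

Lemma surv01 k e : 0 <= surv p k e <= 1.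
Proof.
elim: k e => [|k IH] e /=; first by rewrite ler01 lexx.
have [] := @prod_sub_bounds R (fun i => p * surv p k (shiftv [:: i] e)) (e [::]).
  move=> i; have /andP[h0 h1] := IH (shiftv [:: i] e).
  by rewrite mulr_ge0 ?(ltW p_gt0)//= mulr_ile1// ltW.
by move=> /andP[h0 h1] _ _ _; rewrite subr_ge0 h1 lerBlDl lerDr.
Qed.

Lemma measurable_surv k : measurable_fun setT (q k).
Proof.
elim: k => [|k IH] /=; first exact: measurable_cst.
apply: (@measurable_count R
  (fun z (e : env) => 1 - \prod_(i < z) (1 - p * surv p k (shiftv [:: val i] e)))) => z.
apply: measurable_funB => //; apply: measurable_prod => i _.
apply: measurable_funB => //; apply: measurable_funM => //.
exact: (measurable_child _ IH).
Qed.

Lemma mean_surv_ex k : exists a, has_mean G setT (q k) a.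
Proof.
apply: (mean_dominated (measurable_surv k) (g := fun=> 1) _ (mean_cstT G 1)) => e.
by have /andP[q0 q1] := surv01 k e; rewrite ger0_norm.
Qed.

Let c k : R := sval (cid (mean_surv_ex k)).

Let mean_q k : has_mean G setT (q k) (c k).
Proof. exact: svalP (cid (mean_surv_ex k)). Qed.

Let c0E : c 0%N = 1.
Proof. exact: mean_unique (mean_q 0) (mean_cstT G 1). Qed.

Let rm k (e : env) : R := p * csum (q k) e - q k.+1 e.

(** [prod_sub_bounds] for the probabilities [p * q k] of being joined through a given child. The
    last bound keeps a single pair of children. *)
Let rm_bounds k e : [/\ 0 <= rm k e, 2 * rm k e <= p ^+ 2 * psum (q k) e &
  (1 < e [::])%N ->
  p ^+ 2 * (q k (shiftv [:: 0%N] e) * q k (shiftv [:: 1%N] e)) <= rm k e].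
Proof.
have [] := @prod_sub_bounds R (fun i => p * surv p k (shiftv [:: i] e)) (e [::]).
  move=> i; have /andP[h0 h1] := surv01 k (shiftv [:: i] e).
  by rewrite mulr_ge0 ?(ltW p_gt0)//= mulr_ile1// ltW.
rewrite -mulr_sumr -/(csum (q k) e) => _.
rewrite (_ : _ - 1 + _ = rm k e); last by rewrite /rm /q /=; ring.
move=> -> h2 h3; split => //.
- apply: (le_trans h2); rewrite /psum mulrBr exprMn lerD2l lerN2 /csum mulr_sumr.
  by rewrite le_eqVlt; apply/orP; left; apply/eqP; apply: eq_bigr => i _; rewrite exprMn.
- move=> /h3; apply: le_trans; rewrite le_eqVlt; apply/orP; left; apply/eqP.
  by rewrite /q; ring.
Qed.

(** Criticality, [p * mu = 1], gives [p * csum (q k)] the same mean as [q k]. *)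
Let mean_rm k : has_mean G setT (rm k) (c k - c k.+1).
Proof.
have q0 (e : env) : 0 <= q k e by have /andP[] := surv01 k e.
have := mean_scale p measurableT (mean_csum GW mean1 q0 (mean_q k)).
rewrite mulrA mup mul1r => h; exact: (mean_sub measurableT h (mean_q k.+1)).
Qed.

Let mean_qsq_ex k : exists a, has_mean G setT (fun e => q k e ^+ 2) a.
Proof.
apply: (mean_dominated (g := fun=> 1) _ _ (mean_cstT G 1)).
  by apply: measurable_funX; exact: measurable_surv.
move=> e; have /andP[q0 q1] := surv01 k e.
by rewrite ger0_norm ?sqr_ge0// expr_le1.
Qed.

Let d k : R := sval (cid (mean_qsq_ex k)).

Let mean_qsq k : has_mean G setT (fun e => q k e ^+ 2) (d k).
Proof. exact: svalP (cid (mean_qsq_ex k)). Qed.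

Let d_ge0 k : 0 <= d k.
Proof. by apply: (mean_ge0 measurableT _ (mean_qsq k)) => e _; exact: sqr_ge0. Qed.

Let m21 : 0 <= m2 - mu.
Proof.
apply: (mean_ge0 measurableT _ (mean_sub measurableT mean2 mean1)) => e _.
by rewrite subr_ge0 -natrX ler_nat; case: (e [::]) => // n; rewrite expnS leq_pmulr.
Qed.

Let K1 : R := p ^+ 2 * (m2 - mu).

Let K1_ge0 : 0 <= K1.
Proof. by rewrite mulr_ge0// sqr_ge0. Qed.

(** [rm k] is at most [p ^+ 2 * psum (q k)], whose mean factorizes over pairs of distinct children.
    This keeps the ratio of consecutive [c k] close to 1. *)
Let c_lower k : c k - c k.+1 <= K1 * c k ^+ 2.
Proof.
have q0 (e : env) : 0 <= q k e by have /andP[] := surv01 k e.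
have h := mean_scale (p ^+ 2) measurableT (mean_psum GW mean1 mean2 q0 (mean_q k) (mean_qsq k)).
rewrite -mulrA; apply: (mean_mono measurableT _ (mean_rm k) h) => e _.
have [r0 r2 _] := rm_bounds k e; apply: le_trans r2; lra.
Qed.

Definition branches (e : env) : R := (1 < e [::])%N%:R.

Lemma measurable_branches : measurable_fun setT branches.
Proof.
apply: (@measurable_count R (fun z (e : env) => (1 < z)%N%:R)) => z.
exact: measurable_cst.
Qed.

Lemma mean_branches_ex : exists a, has_mean G setT branches a.
Proof.
apply: (mean_dominated measurable_branches (g := fun=> 1) _ (mean_cstT G 1)) => e.
by rewrite /branches; case: (_ < _)%N; rewrite ?normr1 ?normr0.
Qed.

Definition branch_prob : R := sval (cid mean_branches_ex).
Let th := branch_prob.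

Lemma mean_branches : has_mean G setT branches th.
Proof. exact: svalP (cid mean_branches_ex). Qed.

(** Otherwise the root would almost surely have at most one child, and [mu] would be at most 1. *)
Lemma branch_prob_gt0 : 0 < th.
Proof.
have th0 : 0 <= th.
  by apply: (mean_ge0 measurableT _ mean_branches) => e _; rewrite /branches ler0n.
rewrite lt_neqAle th0 andbT; apply/negP => /eqP th0E.
have [b /andP[_ a1] Na] :
    exists2 a, 0 <= a <= 1 & has_mean G setT (fun e : env => (e [::])%:R : R) a.
  apply: (mean_count_le (h := fun=> 1) (mean_measurable mean1)) => //.
    move=> z; have mz := measurable_root_count z; exists (rootp G z * z%:R); last first.
      by apply: (mean_eq mz _ (mean_cst G z%:R mz)) => e ez; rewrite -[z]ez.
    have [z1|z1] := leqP z 1.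
      by rewrite ler_wpM2l ?rootp_ge0// -[leRHS]/(1%:R) ler_nat.
    suff -> : rootp G z = 0 by rewrite !mul0r.
    apply/eqP; rewrite eq_le rootp_ge0 andbT th0E.
    apply: (mean_mono measurableT _ (mean_root G z) mean_branches) => e _.
    rewrite indicE /branches; have [|] := boolP (e \in root_count z) => // ez.
    by have := set_mem ez; rewrite /root_count /= => ->; rewrite z1.
  exact: mean_cstT.
by have := mean_unique Na mean1 => a_mu; move: a1; rewrite a_mu leNgt mu_gt1.
Qed.

Let a : R := p ^+ 2 * th.

Let a_gt0 : 0 < a.
Proof. by rewrite mulr_gt0 ?exprn_gt0// branch_prob_gt0. Qed.

Lemma mean_branches_child (f : env -> R) x : (forall e, 0 <= f e) ->
  has_mean G setT f x ->
  has_mean G setT (fun e => branches e * f (shiftv [:: 0%N] e)) (th * x).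
Proof.
move=> f0 fx.
have mf : measurable_fun setT (fun e : env => branches e * f (shiftv [:: 0%N] e)).
  apply: measurable_funM; first exact: measurable_branches.
  by apply: measurable_child; exact: mean_measurable fx.
apply: (mean_count (h := fun z => (1 < z)%N%:R * x) mf).
- by move=> e; rewrite /branches mulr_ge0.
- move=> z; have mz := measurable_root_count z.
  have := mean_scale (1 < z)%N%:R mz (mean_child GW z 0 fx); rewrite mulrCA.
  by apply: mean_eq => // e ez; rewrite /branches (_ : e [::] = z).
- rewrite mulrC; apply: (mean_eq measurableT _ (mean_scale x measurableT mean_branches)).
  by move=> e _; rewrite mulrC.
Qed.

Lemma mean_branches_children (f : env -> R) x : (forall e, 0 <= f e) ->
  has_mean G setT f x -> has_mean G setT
  (fun e => branches e * (f (shiftv [:: 0%N] e) * f (shiftv [:: 1%N] e)))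
  (th * x ^+ 2).
Proof.
move=> f0 fx.
have mf : measurable_fun setT
    (fun e : env => branches e * (f (shiftv [:: 0%N] e) * f (shiftv [:: 1%N] e))).
  apply: measurable_funM; first exact: measurable_branches.
  by apply: measurable_funM; apply: measurable_child; exact: mean_measurable fx.
apply: (mean_count (h := fun z => (1 < z)%N%:R * x ^+ 2) mf).
- by move=> e; rewrite /branches !mulr_ge0.
- move=> z; have mz := measurable_root_count z.
  have h := mean_children GW z (isT : 0%N != 1%N) fx fx.
  have := mean_scale (1 < z)%N%:R mz h; rewrite mulrCA -expr2.
  by apply: mean_eq => // e ez; rewrite /branches (_ : e [::] = z).
- rewrite mulrC; apply: (mean_eq measurableT _ (mean_scale (x ^+ 2) measurableT mean_branches)).
  by move=> e _; rewrite mulrC.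
Qed.

Let mean_branch_children k : has_mean G setT
  (fun e => branches e * (q k (shiftv [:: 0%N] e) * q k (shiftv [:: 1%N] e)))
  (th * c k ^+ 2).
Proof.
by apply: mean_branches_children => // e; have /andP[] := surv01 k e.
Qed.

(** Only the pair formed by the first two children is kept in the lower bound for [rm k]; it is
    present with probability [th]. *)
Let c_upper k : a * c k ^+ 2 <= c k - c k.+1.
Proof.
have h := mean_scale (p ^+ 2) measurableT (mean_branch_children k).
rewrite /a -mulrA; apply: (mean_mono measurableT _ h (mean_rm k)) => e _.
have [r0 _] := rm_bounds k e.
by rewrite /branches; case: (_ < _)%N; rewrite ?mul0r ?mulr0// mul1r; exact.
Qed.

(** With at least two children, 1 - (1 - X)(1 - Y) P >= XY, where X and Y belong to the first two
    children and P, in [0, 1], collects the others. Taking means bounds [c k.+1] below by a multiple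
    of [c k ^+ 2]. *)
Let c_gt0 k : 0 < c k.
Proof.
elim: k => [|k IH]; first by rewrite c0E.
suff : p ^+ 2 * th * c k ^+ 2 <= c k.+1.
  by apply: lt_le_trans; rewrite !mulr_gt0// ?exprn_gt0// branch_prob_gt0.
have h := mean_scale (p ^+ 2) measurableT (mean_branch_children k).
rewrite -mulrA; apply: (mean_mono measurableT _ h (mean_q k.+1)) => e _.
rewrite /branches; have [e1|e1] := boolP (1 < _)%N; last first.
  by rewrite mul0r mulr0; have /andP[] := surv01 k.+1 e.
rewrite mul1r /q /=; case: (e [::]) e1 => [|[|n]]// _.
rewrite !big_ord_recl /=.
set x := surv _ _ _; set y := surv _ _ _; set P := \prod_(_ < _) _.
have /andP[x0 x1] : 0 <= x <= 1 := surv01 _ _.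
have /andP[y0 y1] : 0 <= y <= 1 := surv01 _ _.
have P01 : 0 <= P <= 1.
  have [] := @prod_sub_bounds R (fun i => p * surv p k (shiftv [:: i.+2] e)) n => //.
  move=> i; have /andP[h0 h1] := surv01 k (shiftv [:: i.+2] e).
  by rewrite mulr_ge0 ?(ltW p_gt0)//= mulr_ile1// ltW.
have /andP[P0 P1] := P01.
have X0 : 0 <= p * x by rewrite mulr_ge0// ltW.
have Y0 : 0 <= p * y by rewrite mulr_ge0// ltW.
have X1 : p * x <= 1 by rewrite mulr_ile1// ltW.
have Y1 : p * y <= 1 by rewrite mulr_ile1// ltW.
have XY0 : 0 <= (1 - p * x) * (1 - p * y) by rewrite mulr_ge0// subr_ge0.
have h1 : (1 - p * x) * ((1 - p * y) * P) <= (1 - p * x) * (1 - p * y).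
  by rewrite mulrA ler_piMr.
have h2 : p ^+ 2 * (x * y) = (p * x) * (p * y) by ring.
rewrite h2; move: (p * x) (p * y) X0 Y0 X1 Y1 h1 XY0 => X Y *; nra.
Qed.

Let c_cvg0 : c @ \oo --> (0 : R).
Proof. exact: cvg_sum_sqr a_gt0 c_gt0 c_upper. Qed.

(** Since [p ^+ 2 * mu = p], the diagonal contracts by [p]; distinct pairs of children contribute
    the term with [K1]. *)
Let mean_csumW_sqr (f : env -> R) x y : has_mean G setT f x ->
  has_mean G setT (fun e => f e ^+ 2) y ->
  has_mean G setT (fun e => (p * csum f e) ^+ 2) (p * y + K1 * x ^+ 2).
Proof.
move=> fx fy; have := mean_scale (p ^+ 2) measurableT (mean_csum_sqr GW mean1 mean2 fx fy).
rewrite (_ : p ^+ 2 * _ = (p * mu) * p * y + K1 * x ^+ 2); last by rewrite /K1; ring.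
by rewrite mup mul1r; apply: mean_eq => // e _; rewrite exprMn.
Qed.

Let d_rec k : d k.+1 <= p * d k + K1 * c k ^+ 2.
Proof.
apply: (mean_mono measurableT _ (mean_qsq k.+1) (mean_csumW_sqr (mean_q k) (mean_qsq k))) => e _.
have [r0 _ _] := rm_bounds k e; have /andP[q0 _] := surv01 k.+1 e.
rewrite ler_sqr ?nnegrE//; move: r0; rewrite /rm subr_ge0 //.
by apply: le_trans.
Qed.

Let eps_cvg (x : R) : (fun k => x * K1 * c k) @ \oo --> (0 : R).
Proof. by rewrite -[X in _ --> X](mulr0 (x * K1)); apply: cvgMr. Qed.

(** Squaring (1 - K1 c_k) c_k <= c_(k+1) and dropping the square of K1 c_k. When K1 c_k > 1 the left
    side is negative. Together with [c4_slow] this supplies the slow decay asked for by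
    [forced_recursion]. *)
Let csq_slow k : (1 - 2 * K1 * c k) * c k ^+ 2 <= c k.+1 ^+ 2.
Proof.
have h := c_lower k; have [c1 c2] := (c_gt0 k, c_gt0 k.+1).
have [x|x] := leP (K1 * c k) 1; last first.
  apply: (@le_trans _ _ 0); last exact: sqr_ge0.
  rewrite pmulr_lle0 ?exprn_gt0//; lra.
have h1 : (1 - K1 * c k) * c k <= c k.+1 by lra.
have h2 : ((1 - K1 * c k) * c k) ^+ 2 <= c k.+1 ^+ 2.
  have h0 : 0 <= (1 - K1 * c k) * c k by rewrite mulr_ge0 ?subr_ge0// ltW.
  by rewrite ler_sqr ?nnegrE// ltW.
apply: le_trans h2; rewrite [leRHS]exprMn ler_wpM2r ?sqr_ge0//.
have := sqr_ge0 (K1 * c k); lra.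
Qed.

Let c4_slow k : (1 - 4 * K1 * c k) * (c k ^+ 2) ^+ 2 <= (c k.+1 ^+ 2) ^+ 2.
Proof.
have h := csq_slow k; have c2 : 0 < c k ^+ 2 by rewrite exprn_gt0.
have [x|x] := leP (2 * (K1 * c k)) 1; last first.
  apply: (@le_trans _ _ 0); last exact: sqr_ge0.
  rewrite pmulr_lle0 ?exprn_gt0//; lra.
have h2 : ((1 - 2 * K1 * c k) * c k ^+ 2) ^+ 2 <= (c k.+1 ^+ 2) ^+ 2.
  have h0 : 0 <= (1 - 2 * K1 * c k) * c k ^+ 2.
    by rewrite mulr_ge0 ?sqr_ge0//; lra.
  by rewrite ler_sqr ?nnegrE ?sqr_ge0.
apply: le_trans h2; rewrite [leRHS]exprMn ler_wpM2r ?sqr_ge0//.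
have := sqr_ge0 (2 * K1 * c k); lra.
Qed.

(** The second moment of [q k] is of the order of its squared mean; through [mean_psum_sqr_le] this
    makes the remainder O(c_k^2) in L^2. *)
Let d_le : exists K k0, 0 <= K /\ forall k, (k0 <= k)%N -> d k <= K * c k ^+ 2.
Proof.
apply: (forced_recursion (r := p) (C := K1) (k1 := 0) _ csq_slow (eps_cvg 2)) => //.
- by move=> k; rewrite exprn_gt0.
- by rewrite (ltW p_gt0) p_lt1.
Qed.

Lemma gwW_ge0 k e : 0 <= gwW p k e.
Proof.
elim: k e => [|k IH] e /=; first exact: ler01.
by rewrite mulr_ge0 ?(ltW p_gt0)// sumr_ge0.
Qed.

Lemma mean_gwW k : has_mean G setT (W k) 1.
Proof.
elim: k => [|k IH]; first exact: mean_cstT.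
have := mean_scale p measurableT (mean_csum GW mean1 (gwW_ge0 k) IH).
by rewrite mulr1 mup.
Qed.

(** The second moments satisfy w_(k+1) = p w_k + K1, and this recursion preserves the bound 1 + K1 /
    (1 - p). *)
Lemma mean_gwW_sqr : exists2 Kw, 0 < Kw &
  forall k, exists2 w, w <= Kw & has_mean G setT (fun e => W k e ^+ 2) w.
Proof.
have p1 : 0 < 1 - p by rewrite subr_gt0.
have K0 : 0 <= K1 / (1 - p) by rewrite divr_ge0// ltW.
exists (1 + K1 / (1 - p)); first by rewrite ltr_pwDl.
elim=> [|k [w wK Ww]].
  exists 1; first by rewrite lerDl.
  by have := mean_cstT G 1; apply: mean_eq => // e _; rewrite /W /= expr1n.
exists (p * w + K1 * 1 ^+ 2); last exact: mean_csumW_sqr (mean_gwW k) Ww.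
apply: (@le_trans _ _ (p * (1 + K1 / (1 - p)) + K1)).
  by rewrite expr1n mulr1 lerD2r ler_wpM2l// ltW.
have -> : p * (1 + K1 / (1 - p)) + K1 = p + K1 / (1 - p).
  by field; rewrite gt_eqF.
by rewrite lerD2r ltW.
Qed.

Let Dl k (e : env) : R := q k e - c k * W k e.

Let mean_Dl k : has_mean G setT (Dl k) 0.
Proof.
have := mean_sub measurableT (mean_q k) (mean_scale (c k) measurableT (mean_gwW k)).
by rewrite mulr1 subrr.
Qed.

Let mean_Dl_sqr_ex k : exists x, has_mean G setT (fun e => Dl k e ^+ 2) x.
Proof.
have [Kw _ /(_ k) [w _ Ww]] := mean_gwW_sqr.
have h := mean_add measurableT (mean_scale 2 measurableT (mean_qsq k))
  (mean_scale (2 * c k ^+ 2) measurableT Ww).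
apply: (mean_dominated _ _ h).
  by apply: measurable_funX; exact: mean_measurable (mean_Dl k).
move=> e; rewrite ger0_norm ?sqr_ge0// /Dl.
rewrite -[2 * c k ^+ 2 * _]mulrA -exprMn.
by move: (q k e) (c k * W k e) => x y; have := sqr_ge0 (x + y); lra.
Qed.

Let D k : R := sval (cid (mean_Dl_sqr_ex k)).

Let mean_Dl_sqr k : has_mean G setT (fun e => Dl k e ^+ 2) (D k).
Proof. exact: svalP (cid (mean_Dl_sqr_ex k)). Qed.

(* The first term has mean 0 and its second moment is [p] times that of [Dl k];
   the second one is of order [c k ^+ 2] in L^2. *)
Let DlS k e : Dl k.+1 e = p * csum (Dl k) e + ((c k - c k.+1) * W k.+1 e - rm k e).
Proof.
have -> : csum (Dl k) e = csum (q k) e - c k * csum (W k) e.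
  by rewrite /csum mulr_sumr -sumrB.
rewrite /Dl /rm (_ : W k.+1 e = p * csum (W k) e)//; ring.
Qed.

(** In the square of [DlS], weighted AM-GM enlarges the ratio [p] of the centred term only to (1 +
    p) / 2. The other terms cost (c_k - c_(k+1))^2 E W_(k+1)^2 and a multiple of the second moment
    of [psum (q k)], both O(c_k^4). *)
Let D_rec : exists C k1, 0 <= C /\ forall k, (k1 <= k)%N ->
  D k.+1 <= (1 + p) / 2 * D k + C * (c k ^+ 2) ^+ 2.
Proof.
have [K [k1 [K0 dK]]] := d_le; have [Kw Kw0 HW] := mean_gwW_sqr.
have m40 : 0 <= m4.
  by apply: (mean_ge0 measurableT _ mean4) => e _; exact: exprn_ge0.
have p1 : 0 < 1 - p by rewrite subr_gt0.
(* The weight conjugate to (1 + p) / (2 p): with 1 + x equal to the latter, [s] is 1 + 1 / x. *)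
pose s := (1 + p) / (1 - p).
have s0 : 0 <= s.
  by rewrite divr_ge0 ?(ltW p1)// addr_ge0 ?ler01 ?(ltW p_gt0).
(* The first summand pays for the term with [W k.+1], through [c_lower] and [Kw]; the second for
   [rm k], through [m4] and [d_le]. *)
pose C := s * (2 * K1 ^+ 2 * Kw + p ^+ 4 * m4 * K ^+ 2 / 2).
exists C, k1; split.
  rewrite mulr_ge0// addr_ge0//; first by rewrite !mulr_ge0// ltW.
  by rewrite !mulr_ge0// ?exprn_ge0// ltW.
move=> k kk1; have [w wK Ww] := HW k.+1.
have [r /andP[r0 r1] hr] := mean_psum_sqr_le GW mean4 (measurable_surv k) (mean_qsq k).
have h1 := mean_scale ((1 + p) / (2 * p)) measurableT
  (mean_csumW_sqr (mean_Dl k) (mean_Dl_sqr k)).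
have h2 := mean_scale (s * (2 * (c k - c k.+1) ^+ 2)) measurableT Ww.
have h3 := mean_scale (s * (p ^+ 4 / 2)) measurableT hr.
have h := mean_add measurableT h1 (mean_add measurableT h2 h3).
have : D k.+1 <= _ := mean_mono measurableT _ (mean_Dl_sqr k.+1) h.
rewrite expr0n mulr0 addr0 => DS; apply: (le_trans (DS _)).
  move=> e _; rewrite DlS; set x := p * csum _ _; set y := (c k - c k.+1) * _.
  have [rm0 rm2 _] := rm_bounds k e; set z := rm k e in rm0 rm2 *.
  (* AM-GM, with weights chosen so that [(1 + p) / (2 * p) * p < 1]. *)
  have e1 : (x + (y - z)) ^+ 2 <= (1 + p) / (2 * p) * x ^+ 2 + s * (y - z) ^+ 2.
    rewrite -subr_ge0.
    have -> : (1 + p) / (2 * p) * x ^+ 2 + s * (y - z) ^+ 2 - (x + (y - z)) ^+ 2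
      = ((1 - p) * x - 2 * p * (y - z)) ^+ 2 / (2 * p * (1 - p)).
      by rewrite /s; field; rewrite !gt_eqF.
    by rewrite divr_ge0 ?sqr_ge0// !mulr_ge0// ltW.
  apply: (le_trans e1); rewrite lerD2l.
  have e2 : (y - z) ^+ 2 <= 2 * y ^+ 2 + 2 * z ^+ 2.
    by have := sqr_ge0 (y + z); lra.
  have e3 : 2 * z ^+ 2 <= p ^+ 4 / 2 * psum (q k) e ^+ 2.
    have : (2 * z) ^+ 2 <= (p ^+ 2 * psum (q k) e) ^+ 2.
      by rewrite ler_sqr// ?nnegrE//; [rewrite mulr_ge0|apply: le_trans rm2; rewrite mulr_ge0].
    by rewrite (_ : (p ^+ 2 * _) ^+ 2 = p ^+ 4 * psum (q k) e ^+ 2); [lra|ring].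
  have e4 : s * (y - z) ^+ 2 <= s * (2 * y ^+ 2 + p ^+ 4 / 2 * psum (q k) e ^+ 2).
    by rewrite ler_wpM2l//; lra.
  by apply: (le_trans e4); rewrite /y exprMn le_eqVlt; apply/orP; left; apply/eqP; ring.
have -> : (1 + p) / (2 * p) * (p * D k) = (1 + p) / 2 * D k.
  by field; rewrite gt_eqF.
rewrite lerD2l.
have ler0n2 : 0 <= 2 :> R by [].
have cd : (c k - c k.+1) ^+ 2 <= (K1 * c k ^+ 2) ^+ 2.
  rewrite ler_sqr ?nnegrE ?c_lower//; last exact: mulr_ge0 K1_ge0 (sqr_ge0 _).
  by apply: le_trans (c_upper k); rewrite mulr_ge0 ?sqr_ge0// ltW.
have w0 : 0 <= w by apply: (mean_ge0 measurableT _ Ww) => e _; exact: sqr_ge0.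
have f1 : s * (2 * (c k - c k.+1) ^+ 2) * w <= s * (2 * (K1 * c k ^+ 2) ^+ 2) * Kw.
  apply: ler_pM => //; first exact: mulr_ge0 s0 (mulr_ge0 ler0n2 (sqr_ge0 _)).
  by rewrite ler_wpM2l// ler_wpM2l.
have f2 : r <= m4 * (K * c k ^+ 2) ^+ 2.
  apply: (le_trans r1); rewrite ler_wpM2l// ler_sqr ?nnegrE ?dK//.
  exact: mulr_ge0 K0 (sqr_ge0 _).
have f3 : s * (p ^+ 4 / 2) * r <= s * (p ^+ 4 / 2) * (m4 * (K * c k ^+ 2) ^+ 2).
  by rewrite ler_wpM2l// mulr_ge0// divr_ge0// exprn_ge0// ltW.
apply: (le_trans (lerD f1 f3)); rewrite /C le_eqVlt; apply/orP; left; apply/eqP.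
ring.
Qed.

Let D_le : exists K k0, 0 <= K /\ forall k, (k0 <= k)%N -> D k <= K * (c k ^+ 2) ^+ 2.
Proof.
have [C [k1 [C0 DS]]] := D_rec.
apply: (forced_recursion (r := (1 + p) / 2) (C := C) (k1 := k1) _ c4_slow (eps_cvg 4)) => //.
- by move=> k; rewrite !exprn_gt0.
- by have := p_gt0; have := p_lt1; lra.
Qed.

(** The second moment of q_k / c_k - W_k is D_k / c_k^2, so [D_le] loses one factor c_k^2. The ratio
    of consecutive means is squeezed between 1 - K1 c_k and 1. *)
Lemma surv_moments : exists c' : nat -> R, [/\ forall k, 0 < c' k,
  c' @ \oo --> (0 : R), (fun k => c' k.+1 / c' k) @ \oo --> (1 : R),
  exists S, forall n, \sum_(k < n) c' k ^+ 2 <= S &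
  exists K k0, forall k, (k0 <= k)%N -> exists2 x, x <= K * c' k ^+ 2 &
    has_mean G setT (fun e => (surv p k e / c' k - gwW p k e) ^+ 2) x].
Proof.
exists c; split => //.
- have lb : (fun k => 1 - K1 * c k) @ \oo --> (1 : R).
    rewrite -[X in _ --> X]subr0; apply: cvgB; first exact: cvg_cst.
    by rewrite -[X in _ --> X](mulr0 K1); apply: cvgMr.
  apply: (@squeeze_cvgr _ _ _ _ (fun k => 1 - K1 * c k) (fun=> 1) _ _ _ lb);
    last exact: cvg_cst.
  apply: nearW => k.
  have := c_lower k; have := c_upper k; have ck := c_gt0 k => h1 h2.
  rewrite ler_pdivlMr// ler_pdivrMr// mul1r; apply/andP; split; first by nra.
  have : 0 <= a * c k ^+ 2 by rewrite mulr_ge0 ?(ltW a_gt0)// sqr_ge0.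
  by move/le_trans => /(_ _ h1); rewrite subr_ge0.
- by exists (c 0%N / a); exact: sum_sqr_le a_gt0 c_gt0 c_upper.
- have [K [k0 [_ DK]]] := D_le; exists K, k0 => k kk0.
  have c2 : 0 < c k ^+ 2 by rewrite exprn_gt0.
  exists ((c k ^+ 2)^-1 * D k).
    by rewrite ler_pdivrMl// mulrCA -expr2 DK.
  apply: (mean_eq measurableT _ (mean_scale (c k ^+ 2)^-1 measurableT (mean_Dl_sqr k))) => e _.
  by rewrite /Dl -exprVn -exprMn mulrBr mulrC mulKf ?gt_eqF.
Qed.

End gw_process.

(** The sum of the [f k] has finite mean, hence is finite almost everywhere; it bounds every term
    and forces the terms to 0. *)
Lemma ae_cvg_summable d (T : measurableType d) (R : realType)
    (P : probability T R) (f : nat -> T -> R) (a : nat -> R) (C : R) :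
  (forall k x, 0 <= f k x) -> (forall k, has_mean P setT (f k) (a k)) ->
  (forall n, \sum_(k < n) a k <= C) ->
  {ae P, forall x, (exists M, forall k, f k x <= M) /\
    f ^~ x @ \oo --> (0 : R)}.
Proof.
move=> f0 fa aC.
pose F x := (\sum_(k <oo) (f k x)%:E)%E.
have mf k : measurable_fun setT (EFin \o f k).
  by apply/measurable_EFinP; exact: mean_measurable (fa k).
have F0 x : (0 <= F x)%E by apply: nneseries_ge0 => k _ _; rewrite lee_fin.
have iF : P.-integrable setT F.
  apply/integrableP; split.
    apply: (ge0_emeasurable_sum (P := xpredT)) => k; last by move=> _; exact: mf.
    by move=> x _ _; rewrite lee_fin.
  under eq_integral do rewrite gee0_abs//.
  rewrite integral_nneseries//; last by move=> k x _; rewrite lee_fin.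
  apply: (@le_lt_trans _ _ C%:E); last exact: ltry.
  apply: lime_le.
    apply: is_cvg_nneseries => k _ _; apply: integral_ge0 => x _.
    by rewrite lee_fin.
  apply: nearW => n.
  under eq_bigr do rewrite (fa _).2.
  by rewrite sumEFin lee_fin big_mkord.
have := integrable_ae measurableT iF; apply: filterS => x /(_ I) Fx.
have ub n : series (f ^~ x) n <= fine (F x).
  rewrite -lee_fin fineK// /series/= -sumEFin; apply: nneseries_lim_ge => k _ _.
  by rewrite lee_fin.
have nd : nondecreasing_seq (series (f ^~ x)).
  by apply/nondecreasing_seqP => n; rewrite seriesSr lerDl.
split.
  exists (fine (F x)) => k; apply: le_trans (ub k.+1).
  by rewrite seriesSr lerDr /series/= sumr_ge0.
apply: cvg_series_cvg_0; apply: nondecreasing_is_cvgn => //.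
by exists (fine (F x)) => _ [n _ <-]; exact: ub.
Qed.

Lemma cvg_geometric_increments (R : realType) (u : nat -> R) (C r : R) :
  0 <= r < 1 -> (forall k, `|u k.+1 - u k| <= C * r ^+ k) -> cvgn u.
Proof.
move=> /andP[r0 r1] uS.
have C0 : 0 <= C by have := uS 0%N; rewrite expr0 mulr1; apply: le_trans.
have : cvgn (series (telescope u)).
  apply: normed_cvg; apply: (@series_le_cvg _ _ (geometric C r)).
  - by move=> n /=.
  - by move=> n /=; rewrite mulr_ge0// exprn_ge0.
  - by move=> n; exact: uS.
  - by apply: is_cvg_geometric_series; rewrite ger0_norm.
move=> h; have -> : u = (fun n => u 0%N + series (telescope u) n).
  by apply/funext => n; exact: eq_sum_telescope.
by apply: is_cvgD => //; exact: is_cvg_cst.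
Qed.

(** * Almost sure limits of W_k and of q_k / c_k *)

Section gw_limit.
Context (R : realType) (G : probability env R).
Hypothesis GW : gw_law G.
Variables mu m2 m4 : R.
Hypothesis mean1 : has_mean G setT (fun e : env => (e [::])%:R) mu.
Hypothesis mean2 : has_mean G setT (fun e : env => (e [::])%:R ^+ 2) m2.
Hypothesis mean4 : has_mean G setT (fun e : env => (e [::])%:R ^+ 4) m4.
Hypothesis mu_gt1 : 1 < mu.
Hypothesis root_pos : G (root_count 0) = 0%E.

Let p : R := mu^-1.

Let p_gt0 : 0 < p.
Proof. by rewrite invr_gt0 (lt_trans ltr01). Qed.

Let p_lt1 : p < 1.
Proof. by rewrite invf_lt1// (lt_trans ltr01). Qed.

Let mup : p * mu = 1.
Proof. by rewrite mulVf// gt_eqF// (lt_trans ltr01). Qed.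

Let W k : env -> R := gwW p k.

Let mean_W k : has_mean G setT (W k) 1.
Proof. exact: (mean_gwW GW mean1 mu_gt1). Qed.

Let dW k (e : env) : R := W k.+1 e - W k e.

Let mean_dW k : has_mean G setT (dW k) 0.
Proof. by have := mean_sub measurableT (mean_W k.+1) (mean_W k); rewrite subrr. Qed.

Let dWS k e : dW k.+1 e = p * csum (dW k) e.
Proof.
have -> : csum (dW k) e = csum (W k.+1) e - csum (W k) e by rewrite /csum -sumrB.
by rewrite mulrBr.
Qed.

(** By [dWS] an increment is [p] times a sum of centred independent copies of the previous one, so
    its second moment contracts by [p]; [x] is that of W_1 - W_0. *)
Let mean_dW_sqr : exists x, 0 <= x /\
  forall k, has_mean G setT (fun e => dW k e ^+ 2) (x * p ^+ k).
Proof.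
have [Kw _ HW] := mean_gwW_sqr GW mean1 mean2 mu_gt1.
have [w1 _ W1] := HW 1%N; have [w0 _ W0] := HW 0%N.
have h := mean_add measurableT (mean_scale 2 measurableT W1) (mean_scale 2 measurableT W0).
have [|e|x Hx] := mean_dominated (f := fun e => dW 0 e ^+ 2) _ _ h.
- by apply: measurable_funX; exact: mean_measurable (mean_dW 0).
- rewrite ger0_norm ?sqr_ge0// /dW /W.
  by move: (gwW p 1 e) (gwW p 0 e) => y z; have := sqr_ge0 (y + z); lra.
exists x; split.
  by apply: (mean_ge0 measurableT _ Hx) => e _; exact: sqr_ge0.
elim=> [|k IH]; first by rewrite expr0 mulr1.
have := mean_scale (p ^+ 2) measurableT (mean_csum_sqr GW mean1 mean2 (mean_dW k) IH).
rewrite expr0n mulr0 addr0.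
have -> : p ^+ 2 * (mu * (x * p ^+ k)) = (p * mu) * (x * p ^+ k.+1)
  by rewrite [p ^+ k.+1]exprS; ring.
by rewrite mup mul1r; apply: mean_eq => // e _; rewrite -exprMn -dWS.
Qed.

Lemma ae_cvg_gwW : {ae G, forall e, cvgn (fun k => W k e)}.
Proof.
have [x [x0 Hx]] := mean_dW_sqr.
(* Chosen so that p < r^2 < 1: the squared increments divided by r^(2k) remain summable in mean. *)
pose r := (1 + p) / 2.
have r0 : 0 < r by rewrite divr_gt0// addr_gt0.
have r1 : r < 1 by have := p_lt1; rewrite /r; lra.
have pr : p / r ^+ 2 < 1.
  rewrite ltr_pdivrMr ?exprn_gt0// mul1r /r.
  have : 0 < (1 - p) ^+ 2 by rewrite exprn_gt0// subr_gt0.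
  by move: p => y; lra.
have pr0 : 0 <= p / r ^+ 2 by rewrite divr_ge0 ?sqr_ge0// ltW.
have mf k := mean_scale ((r ^+ 2) ^- k) measurableT (Hx k).
have := ae_cvg_summable (C := x / (1 - p / r ^+ 2)) _ mf; case.
- by move=> k e; rewrite mulr_ge0 ?sqr_ge0// invr_ge0 exprn_ge0// sqr_ge0.
- move=> n.
  have -> : \sum_(k < n) (r ^+ 2) ^- k * (x * p ^+ k) = series (geometric x (p / r ^+ 2)) n.
    rewrite /series/= big_mkord; apply: eq_bigr => k _ /=.
    rewrite [(p / _) ^+ k]exprMn [(r ^- 2) ^+ k]exprVn [LHS]mulrCA.
    by congr (_ * _); exact: mulrC.
  rewrite geometric_seriesE ?lt_eqF//=.
  apply: ler_wpM2r; first by rewrite invr_ge0 subr_ge0 ltW.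
  by rewrite ler_piMr// gerBl exprn_ge0.
move=> A [mA A0 hA]; exists A; split => // e /= ncvg; apply: hA => /= -[[M fM] _].
(* The squared increments are at most M r^(2k), and M <= (1 + M)^2 avoids a square root. *)
apply: ncvg; apply: (@cvg_geometric_increments _ _ (1 + M) r).
  by rewrite (ltW r0) r1.
move=> k; have M0 : 0 <= M.
  apply: le_trans (fM 0%N); apply: mulr_ge0; last exact: sqr_ge0.
  by rewrite invr_ge0 exprn_ge0// sqr_ge0.
have rk0 : 0 < r ^+ k by rewrite exprn_gt0.
have R0 : 0 <= (1 + M) * r ^+ k := mulr_ge0 (addr_ge0 ler01 M0) (ltW rk0).
rewrite -ler_sqr ?nnegrE// real_normK ?num_real//.
have := fM k; rewrite ler_pdivrMl; last by rewrite !exprn_gt0.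
move/le_trans; apply.
rewrite (_ : (r ^+ 2) ^+ k = (r ^+ k) ^+ 2); last by rewrite -!exprM mulnC.
rewrite [leRHS]exprMn mulrC; apply: ler_wpM2r; first exact: sqr_ge0.
by have := sqr_ge0 M; lra.
Qed.

Let W_ge0 k e : 0 <= W k e.
Proof. exact: gwW_ge0 mu_gt1 k e. Qed.

Let small k x : set env := [set e | W k e < x].

Let measurable_small k x : measurable (small k x).
Proof.
rewrite (_ : small k x = setT `&` (W k) @^-1` `]-oo, x[); last first.
  by apply/seteqP; split => e /=; rewrite in_itv/= //; case.
by apply: (mean_measurable (mean_W k)) => //; exact: measurable_itv.
Qed.

Let mean_small k x : has_mean G setT (\1_(small k x) : env -> R) (fine (G (small k x))).
Proof. by apply: mean_indic; exact: measurable_small. Qed.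

Let sprob k x : R := fine (G (small k x)).

Let ind01 (A : set env) e : 0 <= (\1_A e : R) <= 1.
Proof. by rewrite indicE; case: (_ \in _); rewrite ?lexx ?ler01. Qed.

(* Paley-Zygmund: [W <= 1 / 2 + Kw * \1_(W >= 1 / 2) + W ^+ 2 / (4 * Kw)]. *)
Let small_start : exists2 s0, 0 <= s0 < 1 & forall k, sprob k (1 / 2) <= s0.
Proof.
have [Kw K0 HW] := mean_gwW_sqr GW mean1 mean2 mu_gt1.
have h k : sprob k (1 / 2) <= 1 - 1 / (4 * Kw).
  have [w wK Ww] := HW k.
  have h1 := mean_sub measurableT (mean_cstT G (1 / 2 + Kw))
    (mean_scale Kw measurableT (mean_small k (1 / 2))).
  have h2 := mean_add measurableT h1 (mean_scale (1 / (4 * Kw)) measurableT Ww).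
  have : 1 <= 1 / 2 + Kw - Kw * sprob k (1 / 2) + 1 / (4 * Kw) * w.
    apply: (mean_mono measurableT _ (mean_W k) h2) => e _.
    rewrite indicE; have [|] := boolP (e \in _) => h.
      have h' : W k e < 1 / 2 := set_mem h.
      rewrite mulr1 addrK (le_trans (ltW h'))// lerDl mulr_ge0 ?sqr_ge0//.
      by rewrite divr_ge0// mulr_ge0// ltW.
    rewrite mulr0 subr0 -subr_ge0.
    have -> : 1 / 2 + Kw + 1 / (4 * Kw) * gwW p k e ^+ 2 - W k e =
      1 / 2 + (W k e - 2 * Kw) ^+ 2 / (4 * Kw).
      by rewrite /W; field; rewrite gt_eqF.
    by rewrite addr_ge0// divr_ge0 ?sqr_ge0// mulr_ge0// ltW.
  have h3 : 1 / (4 * Kw) * w <= 1 / 4.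
    rewrite [leRHS](_ : _ = 1 / (4 * Kw) * Kw); last by field; rewrite gt_eqF.
    by rewrite ler_wpM2l// divr_ge0// mulr_ge0// ltW.
  move=> h4; rewrite -(ler_pM2l K0) mulrBr mulr1.
  have -> : Kw * (1 / (4 * Kw)) = 1 / 4 by field; rewrite gt_eqF.
  lra.
exists (1 - 1 / (4 * Kw)) => //; apply/andP; split.
  by apply: le_trans (h 0%N); rewrite fine_ge0.
by rewrite gtrBl divr_gt0// mulr_gt0.
Qed.

Let th : R := branch_prob G.

(* If [W k.+1 e < p * x], then [W k < x] at every child, and there are at least
   two children with probability [th]. *)
Let small_step k x : sprob k.+1 (p * x) <= sprob k x - th * sprob k x + th * sprob k x ^+ 2.
Proof.
pose f : env -> R := \1_(small k x); have fm : has_mean G setT f _ := mean_small k x.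
have f0 e : 0 <= f e by have /andP[] := ind01 (small k x) e.
have g1 := mean_sub measurableT (mean_shift GW [:: 0%N] fm) (mean_branches_child GW f0 fm).
have g2 := mean_add measurableT g1 (mean_branches_children GW f0 fm).
(* The indicator of a childless root, of mean 0 by [root_pos], covers the case in which there is no
   child to compare with. *)
have g3 := mean_add measurableT g2 (mean_root G 0).
have : sprob k.+1 (p * x) <= _ := mean_mono measurableT _ (mean_small k.+1 (p * x)) g3.
rewrite /rootp root_pos /= addr0; apply => e _.
have /andP[x0 x1] := ind01 (small k x) (shiftv [:: 0%N] e).
have /andP[y0 y1] := ind01 (small k x) (shiftv [:: 1%N] e).
rewrite -/f in x0 x1 y0 y1.
rewrite [leLHS]indicE; have [es|es] := boolP (e \in _); last first.
  have /andP[z0 _] := ind01 (root_count 0) e; apply: addr_ge0; last exact: z0.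
  rewrite /branches; case: (_ < _)%N; rewrite ?mul1r ?mul0r; nra.
have eW : W k.+1 e < p * x := set_mem es.
have child i : (i < e [::])%N -> f (shiftv [:: i] e) = 1.
  move=> ie; rewrite /f indicE mem_set//.
  have h : \sum_(j < e [::]) W k (shiftv [:: val j] e) < x by rewrite -(ltr_pM2l p_gt0).
  apply: le_lt_trans h; rewrite (bigD1 (Ordinal ie))//= lerDl sumr_ge0//.
rewrite -[true%:R]/(1 : R); have /andP[z0 z1] := ind01 (root_count 0) e.
have [e2|e2] := boolP (1 < e [::])%N.
  have -> : branches R e = 1 by rewrite /branches e2.
  rewrite (child 0%N (ltn_trans (ltn0Sn 0) e2)) (child 1%N e2); lra.
have -> : branches R e = 0 by rewrite /branches (negbTE e2).
have [e0|e0] := posnP (e [::]).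
  have -> : \1_(root_count 0) e = 1 :> R by rewrite indicE mem_set.
  lra.
rewrite (child 0%N e0); lra.
Qed.

Let th01 : 0 < th <= 1.
Proof.
rewrite (branch_prob_gt0 mean1 mu_gt1)/=.
apply: (mean_mono measurableT _ (mean_branches G) (mean_cstT G 1)) => e _.
by rewrite /branches; case: (_ < _)%N.
Qed.

(** [small_step] sends s to s (1 - th (1 - s)), so once s <= s0 each step gains the factor r = 1 -
    th (1 - s0), at the price of one level and a factor [p] in the threshold. This is why j <= k. *)
Let small_geometric : exists s0 r, [/\ 0 <= s0, 0 <= r < 1 &
  forall j k, (j <= k)%N -> sprob k (p ^+ j * (1 / 2)) <= s0 * r ^+ j].
Proof.
have [s0 /andP[s00 s01] hs] := small_start; have /andP[t0 t1] := th01.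
pose r := 1 - th * (1 - s0); exists s0, r.
have r0 : 0 <= r by rewrite /r; nra.
have r1 : r < 1 by rewrite gtrBl mulr_gt0// subr_gt0.
split => //; first by rewrite r0.
elim=> [|j IH] k jk; first by rewrite !expr0 mul1r mulr1.
case: k jk => // k jk; rewrite exprS -mulrA.
apply: (le_trans (small_step _ _)).
have h0 : 0 <= sprob k (p ^+ j * (1 / 2)) by rewrite fine_ge0.
move: (IH k jk) h0; move: (sprob k _) => s sy h0.
have ys : s0 * r ^+ j <= s0 by rewrite ler_piMr// exprn_ile1// ltW.
have ts : th * s <= th * s0 by rewrite ler_wpM2l ?(ltW t0)// (le_trans sy).
have -> : s - th * s + th * s ^+ 2 = s * (1 - th * (1 - s)) by ring.
rewrite [r ^+ _]exprS mulrCA [leRHS]mulrC; apply: ler_pM => //; last by rewrite /r; lra.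
have : th * (1 - s) <= 1 * 1; last by lra.
by apply: ler_pM; lra.
Qed.

(** If W_k tends to 0 then, for every j, W_k < p^j / 2 for all large k. That event is the increasing
    union over K of [F j K], of probability at most s0 r^j; the maximum of j and K keeps k >= j. *)
Lemma ae_gwW_pos : {ae G, forall e, ~ (fun k => W k e) @ \oo --> (0 : R)}.
Proof.
have [s0 [r [s00 /andP[r0 r1] hs]]] := small_geometric.
pose F j K : set env := \bigcap_(k in [set k | (maxn j K <= k)%N]) small k (p ^+ j * (1 / 2)).
have mF j K : measurable (F j K).
  by apply: bigcap_measurable => [|k _]; [exists (maxn j K) => /=|exact: measurable_small].
have mU j : measurable (\bigcup_K F j K) by exact: bigcup_measurable.
have hU j : (G (\bigcup_K F j K) <= (s0 * r ^+ j)%:E)%E.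
  have nd : nondecreasing_seq (F j).
    move=> K L KL; apply/subsetPset => e h k /= jk; apply: h => /=.
    by rewrite (leq_trans _ jk)// geq_max leq_maxl (leq_trans KL)// leq_maxr.
  apply: cvge_le (nondecreasing_cvg_mu (mF j) (mU j) nd).
  apply: nearW => K /=.
  apply: (@le_trans _ _ (G (small (maxn j K) (p ^+ j * (1 / 2))))).
    apply: le_measure; rewrite ?inE//; last by apply: bigcap_inf => /=.
  have := hs j (maxn j K) (leq_maxl _ _); rewrite -lee_fin; apply: le_trans.
  by rewrite fineK//; apply: fin_num_measure; exact: measurable_small.
exists (\bigcap_j \bigcup_K F j K); split.
- by apply: bigcap_measurable => //; exists 0%N.
- apply/eqP; rewrite eq_le measure_ge0 andbT.
  have : (fun j => (s0 * r ^+ j)%:E) @ \oo --> (0%:E : \bar R).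
    apply: cvg_EFin; first exact: nearW.
    by apply: cvg_geometric; rewrite ger0_norm.
  apply: cvge_ge; apply: nearW => j; apply: le_trans (hU j).
  apply: le_measure; rewrite ?inE//; last by apply: bigcap_inf.
  by apply: bigcap_measurable => //; exists 0%N.
- move=> e /= /contrapT W0 j _.
  have ej : 0 < p ^+ j * (1 / 2) by rewrite mulr_gt0// exprn_gt0.
  have [K _ hK] := (cvgrPdist_lt _ _).1 W0 _ ej; exists K => // k /= jk.
  have := hK k; rewrite /= sub0r normrN ger0_norm ?W_ge0//; apply.
  by rewrite (leq_trans _ jk)// leq_maxr.
Qed.

(** The second moments of q_k / c_k - W_k are summable, so this difference tends to 0 almost surely,
    while W_k converges to a limit that is nonnegative and, by [ae_gwW_pos], nonzero. *)
Theorem ae_surv_gwW : exists c : nat -> R, [/\ forall k, 0 < c k,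
  c @ \oo --> (0 : R), (fun k => c k.+1 / c k) @ \oo --> (1 : R) &
  {ae G, forall e, exists w : R, [/\ 0 < w, (fun k => gwW p k e) @ \oo --> w &
     (fun k => surv p k e / c k) @ \oo --> w]}].
Proof.
have [c [c0 ccvg cratio [S HS] [K [k0 HK]]]] := surv_moments GW mean1 mean2 mean4 mu_gt1.
exists c; split => //.
(* The moment bounds hold from [k0] on, so the series starts there. *)
have hx k : exists x, x <= K * c (k + k0)%N ^+ 2 /\
    has_mean G setT (fun e => (surv p (k + k0) e / c (k + k0)%N - gwW p (k + k0) e) ^+ 2) x.
  by have [x xK hx] := HK (k + k0)%N (leq_addl _ _); exists x.
pose x k := sval (cid (hx k)).
have xm k : has_mean G setT
    (fun e => (surv p (k + k0) e / c (k + k0)%N - gwW p (k + k0) e) ^+ 2) (x k).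
  by rewrite /x; case: cid => y [].
have xK k : x k <= K * c (k + k0)%N ^+ 2 by rewrite /x; case: cid => y [].
have K0 : 0 <= K.
  have x0 : 0 <= x 0%N by apply: (mean_ge0 measurableT _ (xm 0%N)) => e _; exact: sqr_ge0.
  have c2 : 0 < c (0 + k0)%N ^+ 2 by rewrite exprn_gt0.
  by rewrite -(@pmulr_lge0 _ _ _ c2) (le_trans x0).
have := ae_cvg_summable (C := K * S) _ xm; case.
- by move=> k e; exact: sqr_ge0.
- move=> n; apply: (@le_trans _ _ (K * \sum_(k < n) c (k + k0)%N ^+ 2)).
    by rewrite mulr_sumr; apply: ler_sum => k _; exact: xK.
  rewrite ler_wpM2l//; apply: le_trans (HS (n + k0)%N).
  rewrite addnC big_split_ord/=; under eq_bigr do rewrite addnC.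
  by rewrite lerDr sumr_ge0// => i _; exact: sqr_ge0.
move=> A [mA A0 hA].
have h1 : {ae G, forall e, (fun k => (surv p (k + k0) e / c (k + k0)%N - gwW p (k + k0) e) ^+ 2)
    @ \oo --> (0 : R)}.
  by exists A; split => // e /= ne; apply: hA => /= -[_].
have FG : Filter (almost_everywhere G) by exact: ae_filter_ringOfSetsType.
apply: (@filterS3 _ (almost_everywhere G) FG _ _ _ _ _ h1 ae_cvg_gwW ae_gwW_pos).
move=> e {}h1 h2 h3.
have gw0 : 0 <= limn (fun k => gwW p k e).
  by apply: limr_ge => //; apply: nearW => k; exact: W_ge0.
exists (limn (fun k => gwW p k e)); split => //.
  rewrite lt_neqAle gw0 andbT; apply/negP => /eqP l0; apply: h3.
  by rewrite l0.
have h4 : (fun k => surv p k e / c k - gwW p k e) @ \oo --> (0 : R).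
  rewrite -(cvg_shiftn k0); apply/cvgrPdist_lt => y y0.
  have [n0 _ hn0] := (cvgrPdist_lt _ _).1 h1 _ (exprn_gt0 2 y0).
  exists n0 => // k /hn0 /=.
  rewrite !sub0r !normrN normrX ltr_sqr ?nnegrE//; exact: ltW.
rewrite -[X in _ --> X]add0r.
rewrite (_ : (fun k => surv p k e / c k) =
  (fun k => (surv p k e / c k - gwW p k e) + gwW p k e)); last first.
  by apply/funext => k; rewrite subrK.
exact: cvgD.
Qed.

End gw_limit.

(** * Percolation on a fixed tree *)

(** Together with [opath] and [lvl], a Boolean description of tree, open paths and generations that
    peels off the edge at the root, in step with the recursions of [surv] and [gwW]. [opath] looks
    at edge states only and leaves membership in the tree to [intree]. *)
Fixpoint intree (c : vertex -> nat) (v : vertex) : bool :=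
  if v is i :: w then (i < c [::])%N && intree (shiftv [:: i] c) w else true.

Fixpoint opath (b : vertex -> bool) (v : vertex) : bool :=
  if v is i :: w then b [:: i] && opath (shiftv [:: i] b) w else true.

Fixpoint lvl (c : vertex -> nat) (n : nat) : seq vertex :=
  if n is n'.+1 then
    [seq i :: w | i <- iota 0 (c [::]), w <- lvl (shiftv [:: i] c) n']
  else [:: [::]].

Lemma shiftv0 (E : Type) (c : vertex -> E) : shiftv [::] c = c.
Proof. by []. Qed.

Lemma shiftv_cat (E : Type) (c : vertex -> E) v w :
  shiftv (v ++ w) c = shiftv w (shiftv v c).
Proof. by apply/funext => u; rewrite /shiftv catA. Qed.

Lemma intree_cat c v w : intree c (v ++ w) = intree c v && intree (shiftv v c) w.
Proof.
elim: v c => [|i v IH] c /=; first by rewrite shiftv0.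
by rewrite IH -shiftv_cat /= andbA.
Qed.

Lemma opath_cat b v w : opath b (v ++ w) = opath b v && opath (shiftv v b) w.
Proof.
elim: v b => [|i v IH] b /=; first by rewrite shiftv0.
by rewrite IH -shiftv_cat /= andbA.
Qed.

Lemma opath_rcons b v i : opath b (rcons v i) = opath b v && b (rcons v i).
Proof. by rewrite -cats1 opath_cat /= andbT. Qed.

Lemma gw_treeE c v : gw_tree c v <-> intree c v.
Proof.
elim: v c => [|i v IH] c; first by split.
split=> [h|/= /andP[ic /IH h]].
  rewrite /= (h 0%N)//=; apply/IH => k kv.
  by have := h k.+1 kv; rewrite /= /shiftv.
by case=> [|k] //= kv; have := h k kv; rewrite /shiftv.
Qed.

Lemma mem_lvl c n v : (v \in lvl c n) = intree c v && (size v == n).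
Proof.
elim: n c v => [|n IH] c v /=.
  by rewrite inE; case: v => //= i v; rewrite andbF.
apply/allpairsPdep/idP => [[i [w [ic wl ->]]]|].
  by move: wl; rewrite mem_iota /= in ic; rewrite IH /= ic eqSS.
case: v => //= i w /andP[/andP[ic iw] sw]; exists i, w.
by rewrite mem_iota IH iw.
Qed.

Lemma lvl_uniq c n : uniq (lvl c n).
Proof.
elim: n c => [|n IH] c //=; apply: allpairs_uniq_dep => //; first exact: iota_uniq.
by move=> [i v] [j w] _ _ /= [-> ->].
Qed.

Lemma size_lvlS c n :
  size (lvl c n.+1) = \sum_(i < c [::]) size (lvl (shiftv [:: val i] c) n).
Proof.
rewrite /= size_allpairs_dep sumnE big_map -(big_mkord xpredT
  (fun i => size (lvl (shiftv [:: i] c) n))) /index_iota subn0.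
by [].
Qed.

Lemma gwW_lvl (R : realType) (mu : R) c n :
  gwW mu^-1 n c = (size (lvl c n))%:R / mu ^+ n.
Proof.
elim: n c => [|n IH] c; first by rewrite /= expr0 divr1.
rewrite size_lvlS natr_sum /=; under eq_bigr do rewrite IH.
by rewrite -mulr_suml exprS invfM mulrCA mulrA.
Qed.

(** The right side is invariant along an open edge in both directions, hence under the generated
    equivalence; conversely the path from the root is followed edge by edge. *)
Lemma open_clusterE c b v :
  open_cluster (gw_tree c) b v <-> intree c v && opath b v.
Proof.
split.
  have h u w : open_edge (gw_tree c) b u w ->
      (intree c u && opath b u) = (intree c w && opath b w).
    move=> [/gw_treeE Tu /gw_treeE Tw [i [wE bw]]].
    by rewrite Tu Tw wE opath_rcons -wE bw andbT.
  have h' u w : clos_refl_sym_trans vertex (open_edge (gw_tree c) b) u w ->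
      (intree c u && opath b u) = (intree c w && opath b w).
    by elim=> // x y z _ -> _ ->.
  by move=> /h' <-.
elim/last_ind: v => [_|v i IH]; first exact: rst_refl.
rewrite opath_rcons -cats1 intree_cat => /andP[/andP[Tv Ti] /andP[ov bv]].
apply: (@rst_trans _ _ _ v); first by apply: IH; rewrite Tv.
apply: rst_step; split.
- exact/gw_treeE.
- by apply/gw_treeE; rewrite intree_cat Tv.
- by exists i; rewrite cats1; split => //; rewrite -cats1.
Qed.

Fixpoint conn (k : nat) (c : vertex -> nat) (b : vertex -> bool) : bool :=
  if k is k'.+1 then
    has (fun i => b [:: i] && conn k' (shiftv [:: i] c) (shiftv [:: i] b))
      (iota 0 (c [::]))
  else true.

Lemma connE k c b : conn k c b = has (opath b) (lvl c k).
Proof.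
elim: k c b => [|k IH] c b //=; apply/hasP/hasP => [[i ic /andP[bi]]|[v]].
  rewrite IH => /hasP[w wl ow]; exists (i :: w); last by rewrite /= bi.
  by apply/allpairsPdep; exists i, w.
move=> /allpairsPdep[i [w [ic wl ->]]] /= /andP[bi ow]; exists i => //.
by rewrite bi IH; apply/hasP; exists w.
Qed.

Lemma conn_cat n k c b : conn (n + k) c b =
  has (fun v => opath b v && conn k (shiftv v c) (shiftv v b)) (lvl c n).
Proof.
rewrite connE; apply/hasP/hasP => [[u]|[v vl /andP[ov]]].
  rewrite mem_lvl => /andP[uc /eqP su] ou.
  have /andP[c1 c2] : intree c (take n u) && intree (shiftv (take n u) c) (drop n u).
    by rewrite -intree_cat cat_take_drop.
  have /andP[h1 h2] : opath b (take n u) && opath (shiftv (take n u) b) (drop n u).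
    by rewrite -opath_cat cat_take_drop.
  exists (take n u).
    by rewrite mem_lvl c1 size_take su; case: ltngtP => //; lia.
  rewrite h1 connE; apply/hasP; exists (drop n u) => //.
  by rewrite mem_lvl c2 size_drop su; apply/eqP; lia.
rewrite connE => /hasP[w wl ow]; exists (v ++ w); last by rewrite opath_cat ov.
move: vl wl; rewrite !mem_lvl intree_cat size_cat.
by move=> /andP[-> /eqP ->] /andP[-> /eqP ->] /=.
Qed.

Lemma connect_eventE (Xi : Type) (B : vertex -> Xi -> bool) c M :
  [set x | exists2 v, generation M (gw_tree c) v & open_cluster (gw_tree c) (B ^~ x) v] =
  [set x | conn M c (B ^~ x)].
Proof.
apply/seteqP; split => x /=.
  move=> [v [/gw_treeE Tv sv] /open_clusterE/andP[_ ov]].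
  by rewrite connE; apply/hasP; exists v => //; rewrite mem_lvl Tv sv eqxx.
rewrite connE => /hasP[v]; rewrite mem_lvl => /andP[Tv /eqP sv] ov.
by exists v; [split => //; exact/gw_treeE|apply/open_clusterE; rewrite Tv].
Qed.

Definition verts (c : vertex -> nat) (n : nat) : seq vertex :=
  flatten [seq lvl c k | k <- iota 0 n.+1].

Lemma mem_verts c n v : (v \in verts c n) = intree c v && (size v <= n)%N.
Proof.
apply/flatten_mapP/idP => [[k]|/andP[Tv sv]].
  by rewrite mem_iota mem_lvl /= ltnS => kn /andP[-> /eqP ->].
by exists (size v); rewrite ?mem_iota//= ?mem_lvl ?Tv ?eqxx.
Qed.

(** Reduces the event to finitely many tests on paths, which gives its measurability and
    locality. *)
Lemma cluster_eventE (Xi : Type) (B : vertex -> Xi -> bool) c n t :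
  t `<=` tree_trunc n (gw_tree c) ->
  [set x | tree_trunc n (open_cluster (gw_tree c) (B ^~ x)) = t] =
  \bigcap_(v in [set` verts c n]) [set x | opath (B ^~ x) v = (v \in t)].
Proof.
move=> tT; apply/seteqP; split => x /=.
  move=> <- v /=; rewrite mem_verts => /andP[Tv sv].
  apply/idP/idP => [ov|]; first by rewrite mem_set//; split => //; apply/open_clusterE; rewrite Tv.
  by move=> /set_mem[/open_clusterE/andP[]].
move=> h; apply/seteqP; split => v.
  move=> [/open_clusterE/andP[Tv ov] sv].
  by have := h v; rewrite /= mem_verts Tv sv ov => /(_ isT)/esym/set_mem.
move=> tv; have [/gw_treeE Tv sv] := tT _ tv.
have := h v; rewrite /= mem_verts Tv sv => /(_ isT).
by rewrite mem_set// => ov; split => //; apply/open_clusterE; rewrite Tv.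
Qed.

(** * Independence over finitely many disjoint sets of edges *)

Section finite_independence.
Context d d' (Omega : measurableType d) (E : measurableType d') (R : realType).
Variable P : probability Omega R.
Variables (I : choiceType) (X : I -> Omega -> E).
Hypothesis mX : forall i, measurable_fun setT (X i).
Hypothesis indX : mutually_independent P X.

Lemma cylinders_mono (F F' : set I) : F `<=` F' ->
  <<s cylinders X F >> `<=` <<s cylinders X F' >>.
Proof.
move=> FF'; apply: smallest_sub; first exact: smallest_sigma_algebra.
move=> A [K [S [KF mS ->]]]; apply: sub_sigma_algebra.
by exists K, S; split => // i /KF /FF'.
Qed.

(** The first conclusion is carried along so that the intersection over the tail can be paired with
    the next event in [indep_sigma_cylinders]. *)
Lemma indep_bigcap (J : eqType) (s : seq J) (F : J -> set I) (A : J -> set Omega) :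
  uniq s -> (forall i j, i != j -> F i `&` F j = set0) ->
  (forall j, <<s cylinders X (F j) >> (A j)) ->
  <<s cylinders X (\bigcup_(j in [set` s]) F j) >> (\bigcap_(j in [set` s]) A j) /\
  P (\bigcap_(j in [set` s]) A j) = (\prod_(j <- s) P (A j))%E.
Proof.
move=> us Fdisj FA; elim: s us => [_|j s IH /= /andP[js us]].
  rewrite set_nil bigcap_set0 big_nil probability_setT; split => //.
  exact: (@measurableT _ (cyl_type X _)).
have [sA PA] := IH us.
have -> : [set` j :: s] = j |` [set` s].
  by apply/seteqP; split => i /=; rewrite inE => /predU1P.
rewrite bigcap_setU1 bigcup_setU1; split.
  apply: (@measurableI _ (cyl_type X _)).
    by apply: cylinders_mono (FA j); exact: subsetUl.
  by apply: cylinders_mono sA; exact: subsetUr.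
rewrite big_cons -PA; apply: (indep_sigma_cylinders mX indX) (FA j) sA.
rewrite setI_bigcupr bigcup0// => i /= si; apply: Fdisj.
by apply: contraNneq js => ->.
Qed.

End finite_independence.

(** * Probabilities of cluster and connection events *)

Section percolation_probability.
Context d (Xi : measurableType d) (R : realType) (Q : probability Xi R).
Variables (p : R) (B : vertex -> Xi -> bool).
Hypothesis mB : forall v, measurable_fun setT (B v).
Hypothesis indB : mutually_independent Q B.
Hypothesis probB : forall v, Q [set x | B v x] = p%:E.

Let sigma (F : set vertex) : set (set Xi) := <<s cylinders B F >>.

(** The edges of the subtree of [v]. An edge is named by its lower endpoint, so [v] itself, which
    names the edge above it, is excluded. *)
Definition below (v : vertex) : set vertex :=
  [set u | exists s, u = v ++ s /\ s != [::]].

Let sigma_measurable F A : sigma F A -> measurable A.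
Proof. exact: (sub_sigma_measurable (@cylinders_measurable _ _ _ _ _ _ mB F)). Qed.

Let sigma_coord (F : set vertex) v : F v -> sigma F [set x | B v x].
Proof.
move=> Fv; have := @cylinder_preim _ _ _ _ _ B F v [set true] Fv I.
by congr (_ _); apply/seteqP; split => x.
Qed.

Lemma opath_sigma (F : set vertex) v w :
  (forall u, u != [::] -> prefix u w -> F (v ++ u)) ->
  sigma F [set x | opath (shiftv v (B ^~ x)) w].
Proof.
elim: w v => [|i w IH] v Fw.
  rewrite (_ : [set _ | _] = setT); last by apply/seteqP; split.
  exact: (@measurableT _ (cyl_type B F)).
rewrite (_ : [set _ | _] = [set x | B (v ++ [:: i]) x] `&`
    [set x | opath (shiftv (v ++ [:: i]) (B ^~ x)) w]); last first.
  apply/seteqP; split => x /=; rewrite shiftv_cat /shiftv; first by move/andP.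
  by move=> [-> ->].
apply: (@measurableI _ (cyl_type B F)).
  by apply: sigma_coord; apply: Fw => //=; rewrite eqxx prefix0s.
apply: IH => u u0 uw; rewrite -catA; apply: Fw => //=.
by rewrite eqxx.
Qed.

Lemma conn_sigma k c v : sigma (below v) [set x | conn k c (shiftv v (B ^~ x))].
Proof.
rewrite (_ : [set _ | _] =
    \bigcup_(w in [set` lvl c k]) [set x | opath (shiftv v (B ^~ x)) w]).
  apply: (@fin_bigcup_measurable _ (cyl_type B (below v))).
    exact: finite_seq.
  by move=> w _; apply: opath_sigma => u u0 _; exists u.
apply/seteqP; split => x /=; rewrite connE; first by move/hasP => [w wl ow]; exists w.
by move=> [w wl ow]; apply/hasP; exists w.
Qed.

Lemma below_subtree v : below v `<=` subtree v.
Proof. by move=> _ [s [-> _]]; rewrite /subtree /= prefix_prefix. Qed.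

Lemma subtree_disjoint_size u v : size u = size v -> u != v ->
  subtree u `&` subtree v = set0.
Proof.
move=> uv nuv; apply/seteqP; split => // w [] /=; rewrite /subtree /=.
rewrite !prefixE uv => /eqP uE /eqP vE.
by move: nuv; rewrite -uE vE eqxx.
Qed.

(** The connection fails iff, for each child, the edge to it is closed or it is not joined to the
    generation [k] below it. These failures are independent because they use disjoint sets of
    edges. *)
Lemma conn_prob k c v :
  Q [set x | conn k c (shiftv v (B ^~ x))] = (surv p k c)%:E.
Proof.
elim: k c v => [|k IH] c v.
  by rewrite (_ : [set _ | _] = setT) ?probability_setT//; apply/seteqP; split.
pose A i := [set x | B (v ++ [:: i]) x] `&`
  [set x | conn k (shiftv [:: i] c) (shiftv (v ++ [:: i]) (B ^~ x))].
pose F i := subtree (v ++ [:: i]).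
have FA i : sigma (F i) (A i).
  apply: (@measurableI _ (cyl_type B (F i))).
    by apply: sigma_coord; rewrite /F /subtree /= prefix_refl.
  apply: (cylinders_mono (@below_subtree (v ++ [:: i]))); exact: conn_sigma.
have QA i : Q (A i) = (p * surv p k (shiftv [:: i] c))%:E.
  rewrite (indep_sigma_cylinders mB indB (F := [set v ++ [:: i]]) (G := below (v ++ [:: i]))).
  - by rewrite probB IH EFinM.
  - apply/seteqP; split => // _ [-> [s [/esym/eqP sE s0]]].
    by move: sE; rewrite -{2}[v ++ _]cats0 eqseq_cat// eqxx /= (negbTE s0).
  - exact: sigma_coord.
  - exact: conn_sigma.
have Fdisj i j : i != j -> F i `&` F j = set0.
  move=> ij; apply: subtree_disjoint_size; first by rewrite !size_cat.
  by rewrite eqseq_cat// eqxx /= eqseq_cons andbT.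
have FAC i : sigma (F i) (~` A i).
  exact: (@measurableC _ (cyl_type B (F i)) _ (FA i)).
have [_ QC] := indep_bigcap mB indB (iota_uniq 0 (c [::])) Fdisj FAC.
rewrite (_ : [set _ | _] = ~` \bigcap_(i in [set` iota 0 (c [::])]) ~` A i).
  rewrite probability_setC; last first.
    apply: fin_bigcap_measurable; first exact: finite_seq.
    by move=> i _; exact: sigma_measurable (FAC i).
  rewrite QC /=; under eq_bigr => i _.
    rewrite probability_setC ?QA; last exact: sigma_measurable (FA i).
    over.
  rewrite prodEFin -EFinB; congr ((1 - _)%:E).
  by rewrite -(big_mkord xpredT (fun i => 1 - p * surv p k (shiftv [:: i] c)))
    /index_iota subn0.
rewrite setC_bigcap; apply/seteqP; split => x /=.
  move=> /hasP[i ic /andP[bi ci]]; exists i => //; rewrite setCK; split => //=.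
  by rewrite shiftv_cat.
move=> [i ic]; rewrite setCK => -[/= bi ci]; apply/hasP; exists i => //.
by rewrite -shiftv_cat ci andbT.
Qed.

Section tree.
Variables (c : vertex -> nat) (n : nat) (t : set vertex).
Hypothesis tT : t `<=` tree_trunc n (gw_tree c).

Let top : set vertex := [set u | (size u <= n)%N].

Lemma cluster_event_sigma : sigma top (cluster_event B (gw_tree c) n t).
Proof.
rewrite /cluster_event cluster_eventE//.
apply: (@fin_bigcap_measurable _ (cyl_type B top)).
  exact: finite_seq.
move=> v /=; rewrite mem_verts => /andP[_ sv].
have h : sigma top [set x | opath (shiftv [::] (B ^~ x)) v].
  apply: opath_sigma => u _ /prefixP[w vE]; rewrite /top /= (leq_trans _ sv)//.
  by rewrite vE size_cat leq_addr.
have [tv|tv] := boolP (v \in t).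
  rewrite (_ : [set _ | _] = [set x | opath (shiftv [::] (B ^~ x)) v])//.
rewrite (_ : [set _ | _] = ~` [set x | opath (shiftv [::] (B ^~ x)) v]).
  exact: (@measurableC _ (cyl_type B top) _ h).
by apply/seteqP; split => x /=; rewrite shiftv0;
  [move=> -> | move=> /negP/negbTE].
Qed.

Definition frontier : seq vertex := [seq v <- lvl c n | v \in t].

Lemma cluster_conn x : cluster_event B (gw_tree c) n t x -> forall k,
  conn (n + k) c (B ^~ x) =
  has (fun v => conn k (shiftv v c) (shiftv v (B ^~ x))) frontier.
Proof.
rewrite /cluster_event cluster_eventE// => h k; rewrite conn_cat has_filter.
rewrite /frontier has_filter -filter_predI; congr (_ != _).
apply: eq_in_filter => v vl /=; rewrite andbC; congr (_ && _).
apply: h => /=; rewrite mem_verts; move: vl; rewrite mem_lvl.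
by move=> /andP[-> /eqP ->] /=.
Qed.

Lemma connect_event_conn M :
  connect_event B (gw_tree c) M = [set x | conn M c (B ^~ x)].
Proof. exact: connect_eventE. Qed.

Lemma measurable_connect_event M : measurable (connect_event B (gw_tree c) M).
Proof.
rewrite connect_event_conn; exact: sigma_measurable (@conn_sigma M c [::]).
Qed.

Lemma measurable_cluster_event : measurable (cluster_event B (gw_tree c) n t).
Proof. exact: sigma_measurable cluster_event_sigma. Qed.

Lemma connect_event_prob M :
  Q (connect_event B (gw_tree c) M) = (surv p M c)%:E.
Proof. by rewrite connect_event_conn; exact: (conn_prob M c [::]). Qed.

Lemma cluster_connect_prob k :
  fine (Q (cluster_event B (gw_tree c) n t `&` connect_event B (gw_tree c) (n + k))) =
  fine (Q (cluster_event B (gw_tree c) n t)) *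
  (1 - \prod_(v <- frontier) (1 - surv p k (shiftv v c))).
Proof.
set Cl := cluster_event _ _ _ _.
pose A v := ~` [set x | conn k (shiftv v c) (shiftv v (B ^~ x))].
(* [indep_bigcap] asks for disjointness over all labels, but nested vertices share edges; off
   generation [n] the edge set is made empty and the event trivial. *)
pose F v := if size v == n then below v else set0.
have Fdisj u v : u != v -> F u `&` F v = set0.
  rewrite /F => uv; case: eqP => [su|_]; last by rewrite set0I.
  case: eqP => [sv|_]; last by rewrite setI0.
  apply/seteqP; split => // w [/below_subtree wu /below_subtree wv].
  by rewrite -(subtree_disjoint_size _ uv)// su.
pose A' v := if size v == n then A v else setT.
have FA v : sigma (F v) (A' v).
  rewrite /F /A'; case: eqP => _; last exact: (@measurableT _ (cyl_type B _)).
  by apply: (@measurableC _ (cyl_type B (below v))); exact: conn_sigma.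
have us : uniq frontier by rewrite filter_uniq// lvl_uniq.
have [sA QA] := indep_bigcap mB indB us Fdisj FA.
(* [N]: no vertex of the frontier is joined to its [k]-th generation. It depends on edges with lower
   endpoint beyond depth [n], the cluster event on the others. *)
set N := \bigcap_(j in _) _ in sA QA.
have AA' v : v \in frontier -> A' v = A v.
  by rewrite mem_filter mem_lvl /A' => /andP[_ /andP[_ ->]].
have QN : Q N = (\prod_(v <- frontier) (1 - surv p k (shiftv v c)))%:E.
  rewrite QA -prodEFin; apply: eq_big_seq => v vf; rewrite AA'//.
  rewrite probability_setC ?conn_prob//; exact: sigma_measurable (@conn_sigma _ _ _).
have mN : measurable N by exact: sigma_measurable sA.
have mCl : measurable Cl := measurable_cluster_event.
have ClN : Cl `&` connect_event B (gw_tree c) (n + k) = Cl `\` N.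
  rewrite setDE; apply/seteqP; split => x [Cx]; rewrite connect_event_conn /= cluster_conn//.
    move=> /hasP[v vf cv]; split=> // /(_ v vf).
    by rewrite AA'//; exact.
  move=> nN; split => //=; apply: contrapT => /negP/hasPn h; apply: nN => v /= vf.
  by rewrite AA'// /A /=; apply/negP; exact: h.
have -> : Q (Cl `&` connect_event B (gw_tree c) (n + k)) = (Q Cl - Q (Cl `&` N))%E.
  by rewrite ClN; apply: measureD => //; rewrite ltey_eq fin_num_measure.
have -> : Q (Cl `&` N) = (Q Cl * Q N)%E.
  apply: (indep_sigma_cylinders mB indB _ cluster_event_sigma sA).
  apply/seteqP; split => // u [/= un [v /= vf]].
  rewrite /F; case: eqP => // sv [s [uE s0]].
  move: un; rewrite /top /= uE size_cat sv; case: s s0 {uE} => //= i s _.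
  by rewrite addnS ltnNge leq_addr.
rewrite QN fineB ?fin_num_measure//; last by rewrite fin_numM ?fin_num_measure.
by rewrite fineM ?fin_num_measure//= mulrBr mulr1.
Qed.

End tree.
End percolation_probability.

Lemma card_fset_set_seq (T : choiceType) (s : seq T) :
  uniq s -> #|` fset_set [set` s]| = size s.
Proof.
move=> us; have -> : fset_set [set` s] = [fset x in s]%fset.
  apply/fsetP => x; rewrite in_fset_set; last exact: finite_seq.
  by apply/idP/idP; rewrite !inE.
by rewrite card_fseq undup_id.
Qed.

Lemma num_descE c v k : intree c v ->
  num_desc (gw_tree c) v k = size (lvl (shiftv v c) k).
Proof.
move=> Tv; rewrite /num_desc.
have -> : [set u | [/\ gw_tree c u, prefix v u & size u = (size v + k)%N]] =
    [set` [seq v ++ w | w <- lvl (shiftv v c) k]].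
  apply/seteqP; split => u /=.
    move=> [/gw_treeE Tu /prefixP[w uE] su]; apply/mapP; exists w => //.
    move: Tu; rewrite mem_lvl uE intree_cat Tv /= => ->.
    by move: su; rewrite uE size_cat => /addnI ->; rewrite eqxx.
  move=> /mapP[w]; rewrite mem_lvl => /andP[Tw /eqP sw] ->; split.
  - by apply/gw_treeE; rewrite intree_cat Tv.
  - exact: prefix_prefix.
  - by rewrite size_cat sw.
rewrite card_fset_set_seq ?size_map// map_inj_uniq ?lvl_uniq//.
by move=> x y /eqP; rewrite eqseq_cat// eqxx => /eqP.
Qed.

Lemma WlimE (R : realType) (mu : R) c v : intree c v ->
  Wlim mu (gw_tree c) v = limn (fun k => gwW mu^-1 k (shiftv v c)).
Proof.
move=> Tv; congr (lim (_ @ \oo)); apply/funext => k.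
by rewrite gwW_lvl num_descE.
Qed.

(** * The limit of the conditional probabilities *)

Section conditioned_limit.
Context d (Xi : measurableType d) (R : realType) (Q : probability Xi R).
Variables (mu : R) (B : vertex -> Xi -> bool).
Hypothesis mB : forall v, measurable_fun setT (B v).
Hypothesis indB : mutually_independent Q B.
Hypothesis probB : forall v, Q [set x | B v x] = (mu^-1)%:E.

(** To first order, one minus the product is the sum of the [x i k]. Peeling off a factor leaves a
    cross term which, divided by [r k], is a product of two convergent ratios and [r k], so it
    vanishes. *)
Lemma cvg_one_minus_prod (I : Type) (s : seq I) (x : I -> nat -> R)
    (r : nat -> R) (w : I -> R) : (forall k, 0 < r k) -> r @ \oo --> (0 : R) ->
  (forall i, (fun k => x i k / r k) @ \oo --> w i) ->
  (fun k => (1 - \prod_(i <- s) (1 - x i k)) / r k) @ \oo --> \sum_(i <- s) w i.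
Proof.
move=> r0 rcvg xw; elim: s => [|i s IH].
  rewrite big_nil (_ : (fun _ => _) = fun=> 0); first exact: cvg_cst.
  by apply/funext => k; rewrite big_nil subrr mul0r.
rewrite big_cons (_ : (fun _ => _) = fun k => x i k / r k +
  (1 - \prod_(j <- s) (1 - x j k)) / r k -
  (x i k / r k) * ((1 - \prod_(j <- s) (1 - x j k)) / r k * r k)); last first.
  apply/funext => k; rewrite big_cons; field; exact: lt0r_neq0.
rewrite -[X in _ --> X]subr0; apply: cvgB; first exact: cvgD.
rewrite -[X in _ --> X](mulr0 (w i)); apply: cvgM; first exact: xw.
by rewrite -[X in _ --> X](mulr0 (\sum_(j <- s) w j)); exact: cvgM.
Qed.

Variables (c : vertex -> nat) (r : nat -> R).
Hypothesis r0 : forall k, 0 < r k.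
Hypothesis rcvg : r @ \oo --> (0 : R).
Hypothesis rratio : (fun k => r k.+1 / r k) @ \oo --> (1 : R).
Hypothesis cgood : forall v, exists w : R, [/\ 0 < w,
  (fun k => gwW mu^-1 k (shiftv v c)) @ \oo --> w &
  (fun k => surv mu^-1 k (shiftv v c) / r k) @ \oo --> w].

Let w v : R := limn (fun k => gwW mu^-1 k (shiftv v c)).

Let w_gt0 v : 0 < w v.
Proof. by have [x [x0 xW _]] := cgood v; rewrite /w (cvg_lim _ xW). Qed.

Let surv_w v : (fun k => surv mu^-1 k (shiftv v c) / r k) @ \oo --> w v.
Proof. by have [x [x0 xW]] := cgood v; rewrite /w (cvg_lim _ xW). Qed.

Let rratio_shift n : (fun k => r (n + k)%N / r k) @ \oo --> (1 : R).
Proof.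
elim: n => [|n IH].
  rewrite (_ : (fun _ => _) = fun=> 1); first exact: cvg_cst.
  by apply/funext => k; rewrite add0n divff// gt_eqF.
rewrite (_ : (fun _ => _) = fun k => r (n + k).+1 / r (n + k)%N * (r (n + k)%N / r k)); last first.
  by apply/funext => k; rewrite addSn mulrA divfK// gt_eqF.
rewrite -[X in _ --> X]mulr1; apply: cvgM => //.
exact: (cvg_comp (addn n) (fun k => r k.+1 / r k) (cvg_addnl n) rratio).
Qed.

Variables (n : nat) (t : set vertex).
Hypothesis tT : t `<=` tree_trunc n (gw_tree c).

Lemma iic_marginalE : iic_marginal Q B (gw_tree c) mu n t =
  (\sum_(v <- frontier c n t) w v) / w [::] * cluster_prob Q B (gw_tree c) n t.
Proof.
rewrite /iic_marginal WlimE//; congr (_ / _ * _).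
rewrite [RHS]fsbig_seq ?filter_uniq ?lvl_uniq//.
have -> : generation n t = [set` frontier c n t].
  apply/seteqP; split => v /=.
    move=> [tv sv]; have [/gw_treeE Tv _] := tT tv.
    by rewrite mem_filter mem_set// mem_lvl Tv sv eqxx.
  by rewrite mem_filter mem_lvl => /andP[/set_mem tv /andP[_ /eqP]].
apply: eq_fsbigr => v; rewrite inE /= mem_filter mem_lvl => /andP[_ /andP[Tv _]].
by rewrite WlimE.
Qed.

(** The numerator is normalized by [r k] and the denominator by [r (n + k)]; the quotient of the two
    scales tends to 1 by [rratio_shift]. *)
Lemma cond_cluster_cvg :
  (fun M => cond_cluster_prob Q B (gw_tree c) M n t) @ \oo -->
  iic_marginal Q B (gw_tree c) mu n t.
Proof.
rewrite -(cvg_shiftn n).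
rewrite (_ : (fun _ => _) = fun k => cluster_prob Q B (gw_tree c) n t *
  ((1 - \prod_(v <- frontier c n t) (1 - surv mu^-1 k (shiftv v c))) / r k *
  ((r (n + k)%N / r k)^-1 * (surv mu^-1 (n + k) c / r (n + k)%N)^-1))); last first.
  apply/funext => k; rewrite /cond_cluster_prob addnC.
  rewrite (cluster_connect_prob mB indB probB tT) (connect_event_prob mB indB probB)/=.
  have h1 := lt0r_neq0 (r0 k); have h2 := lt0r_neq0 (r0 (n + k)%N).
  rewrite -!mulrA; congr (_ * (_ * _)).
  rewrite !invfM !invrK; move: (surv _ _ _)^-1 => s.
  by field; rewrite h1 h2.
rewrite iic_marginalE mulrC; apply: cvgM; first exact: cvg_cst.
apply: cvgM; first exact: cvg_one_minus_prod.
rewrite -[X in _ --> X]mul1r; apply: cvgM.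
  rewrite -[X in _ --> X]invr1; apply: cvgV; first exact: oner_neq0.
  exact: rratio_shift.
apply: cvgV; first exact: lt0r_neq0.
have h := @surv_w [::]; rewrite shiftv0 in h.
exact: (cvg_comp (addn n) (fun k => surv mu^-1 k c / r k) (cvg_addnl n) h).
Qed.

End conditioned_limit.

(** * The measure of the incipient infinite cluster *)

(* [r] is the reversed sequence of left/right choices leading to the interval
   [cell r], of length [m r]. *)
Section bisection.
Context (R : realType) (m : seq bool -> R).
Hypothesis m_ge0 : forall r, 0 <= m r.
Hypothesis m_nil : m [::] = 1.
Hypothesis m_cons : forall r, m r = m (false :: r) + m (true :: r).

Fixpoint left_end (r : seq bool) : R :=
  if r is b :: r' then left_end r' + (if b then m (false :: r') else 0) else 0.

Definition cell (r : seq bool) : set R :=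
  [set` `[left_end r, left_end r + m r[].

Fixpoint cell_path (x : R) (n : nat) : seq bool :=
  if n is n'.+1 then
    let r := cell_path x n' in (left_end r + m (false :: r) <= x) :: r
  else [::].

Lemma size_cell_path x n : size (cell_path x n) = n.
Proof. by elim: n => //= n ->. Qed.

(** The cells of a given length partition [0, 1[ and [cell_path] picks the one containing [x]: being
    half-open, they match the non-strict comparison with the common endpoint of the two halves. *)
Lemma cellP x r : cell r x <-> 0 <= x < 1 /\ cell_path x (size r) = r.
Proof.
rewrite /cell; elim: r => [|b r IH].
  by rewrite /= in_itv/= m_nil add0r; split => [|[]].
have mr := m_cons r; have m0 := m_ge0 (false :: r); have m1 := m_ge0 (true :: r).
split.
  move=> h; have : x \in `[left_end r, left_end r + m r[.
    by move: h; rewrite /= !in_itv/= mr; case: b => /andP[h1 h2]; apply/andP; split; lra.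
  move=> /IH [x01 xr]; split => //=; rewrite xr; congr (_ :: _).
  move: h; rewrite /= in_itv/=; case: b => /andP[h1 h2]; first by rewrite h1.
  by apply/negbTE; rewrite -ltNge; lra.
move=> [x01] /= [bE xr]; have /IH : 0 <= x < 1 /\ cell_path x (size r) = r by [].
rewrite /= !in_itv/=; move: bE; rewrite xr mr => <- /andP[h1 h2].
by case: ifPn => h; apply/andP; split; try lra; move: h; rewrite -ltNge; lra.
Qed.

Lemma measurable_cell r : measurable (cell r).
Proof. exact: measurable_itv. Qed.

Lemma cell_measure r : lebesgue_measure (cell r) = (m r)%:E.
Proof.
rewrite /cell lebesgue_measure_itv/= lte_fin ltrDl.
have := m_ge0 r; rewrite le_eqVlt => /orP[/eqP <-|m0]; first by rewrite ltxx.
by rewrite m0 -EFinB addrAC subrr add0r.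
Qed.

(** Choice sequences are countable and indexed by their codes. A point outside all of these cells
    meets only patterns of positive mass, which are those exhibited by actual clusters. *)
Definition null_cell (n : nat) : set R :=
  if @choice.unpickle (seq bool) n is Some r then
    if m r == 0 then cell r else set0
  else set0.

Definition null_cells : set R := \bigcup_n null_cell n.

Lemma null_cellsP x r : cell r x -> ~ null_cells x -> 0 < m r.
Proof.
move=> rx nx; rewrite lt_neqAle m_ge0 andbT eq_sym; apply/negP => m0; apply: nx.
by exists (choice.pickle r) => //; rewrite /null_cell choice.pickleK m0.
Qed.

Lemma measurable_null_cell n : measurable (null_cell n).
Proof.
rewrite /null_cell; case: choice.unpickle => // r; case: ifP => // _.
exact: measurable_cell.
Qed.

Lemma measurable_null_cells : measurable null_cells.
Proof. by apply: bigcup_measurable => n _; exact: measurable_null_cell. Qed.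

Lemma null_cells_measure0 : lebesgue_measure null_cells = 0%E.
Proof.
apply/eqP; rewrite eq_le measure_ge0 andbT.
apply: le_trans (generalized_Boole_inequality lebesgue_measure
  measurable_null_cell measurable_null_cells) _.
rewrite eseries0// => n _ _; rewrite /null_cell.
case: choice.unpickle => [r|]; last exact: measure0.
case: ifP => [/eqP m0|_]; last exact: measure0.
exact: etrans (cell_measure r) (congr1 EFin m0).
Qed.

End bisection.

(** * Enumeration of the vertices of the tree *)

Section tree_enumeration.
Variable c : vertex -> nat.
Hypothesis lvl_ne : forall n, lvl c n != [::].

(* An enumeration of the tree, generation after generation; the default of [nth] is
   never reached because no generation is empty ([size_verts]). *)
Definition vtx (i : nat) : vertex := nth [::] (verts c i) i.

Lemma vertsS n : verts c n.+1 = verts c n ++ lvl c n.+1.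
Proof.
rewrite /verts -[in LHS]addn1 iotaD add0n map_cat flatten_cat /=.
by rewrite cats0.
Qed.

Lemma size_verts n : (n < size (verts c n))%N.
Proof.
elim: n => [//|n IH]; rewrite vertsS size_cat.
by rewrite -[n.+2]addn1 leq_add// lt0n size_eq0 lvl_ne.
Qed.

Lemma verts_prefix m n : (m <= n)%N -> prefix (verts c m) (verts c n).
Proof.
move=> /subnK <-; elim: (n - m)%N => [|k IH]; first exact: prefix_refl.
by rewrite addSn vertsS (prefix_trans IH)// prefix_prefix.
Qed.

Lemma nth_prefix (s1 s2 : seq vertex) i : prefix s1 s2 -> (i < size s1)%N ->
  nth [::] s2 i = nth [::] s1 i.
Proof. by move=> /prefixP[s ->] is1; rewrite nth_cat is1. Qed.

Lemma vtxE n i : (i < size (verts c n))%N -> vtx i = nth [::] (verts c n) i.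
Proof.
move=> ni; rewrite /vtx; have [le|/ltnW le] := leqP i n.
  by rewrite (nth_prefix (verts_prefix le)) ?size_verts.
by rewrite (nth_prefix (verts_prefix le)).
Qed.

Definition vidx (v : vertex) : nat := index v (verts c (size v)).

Lemma vidx_lt n v : intree c v -> (size v <= n)%N -> (vidx v < size (verts c n))%N.
Proof.
move=> Tv sv; have h : (vidx v < size (verts c (size v)))%N.
  by rewrite index_mem mem_verts Tv leqnn.
by apply: (leq_trans h); apply: size_prefix; exact: verts_prefix.
Qed.

Lemma vidxK v : intree c v -> vtx (vidx v) = v.
Proof.
move=> Tv; rewrite (vtxE (vidx_lt Tv (leqnn _))) nth_index//.
by rewrite mem_verts Tv leqnn.
Qed.

Lemma vtx_mem n i : (i < size (verts c n))%N ->
  intree c (vtx i) && (size (vtx i) <= n)%N.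
Proof. by move=> ni; rewrite (vtxE ni) -mem_verts mem_nth. Qed.

End tree_enumeration.

(** * Construction of the measure *)

Section iic_existence.
Context d (Xi : measurableType d) (R : realType) (Q : probability Xi R).
Variables (mu : R) (B : vertex -> Xi -> bool).
Hypothesis mB : forall v, measurable_fun setT (B v).
Hypothesis indB : mutually_independent Q B.
Hypothesis probB : forall v, Q [set x | B v x] = (mu^-1)%:E.
Variable c : vertex -> nat.
Hypothesis lvl_ne : forall n, lvl c n != [::].
Hypothesis cond_cvg : forall n t, t `<=` tree_trunc n (gw_tree c) ->
  (fun M => cond_cluster_prob Q B (gw_tree c) M n t) @ \oo -->
  iic_marginal Q B (gw_tree c) mu n t.
Variable M0 : nat.
Hypothesis surv_pos : forall M, (M0 <= M)%N -> 0 < surv mu^-1 M c.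

Let T := gw_tree c.

Let clust x := open_cluster T (B ^~ x).

Definition cprob M (A : set Xi) : R :=
  fine (Q (A `&` connect_event B T M)) / fine (Q (connect_event B T M)).

Let mconn M : measurable (connect_event B T M).
Proof. exact: measurable_connect_event mB c M. Qed.

Lemma cprob_ge0 M A : 0 <= cprob M A.
Proof. by rewrite divr_ge0// fine_ge0. Qed.

Lemma cprobU M (A A' : set Xi) : measurable A -> measurable A' ->
  A `&` A' = set0 -> cprob M (A `|` A') = cprob M A + cprob M A'.
Proof.
move=> mA mA' AA'; rewrite /cprob -mulrDl -fineD ?fin_num_measure//; last 2 first.
- exact: measurableI.
- exact: measurableI.
congr (fine _ / _); rewrite setIUl; apply: measureU.
- exact: measurableI.
- exact: measurableI.
- by rewrite setIACA AA' set0I.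
Qed.

(** The pattern [r] on the first [size r] vertices of the enumeration, the latest bit at the head as
    in [cell]. *)
Fixpoint bits_event (r : seq bool) : set Xi :=
  if r is b :: r' then
    bits_event r' `&` [set x | opath (B ^~ x) (vtx c (size r')) = b]
  else setT.

Let measurable_opath v : measurable [set x | opath (B ^~ x) v].
Proof.
have h : <<s cylinders B setT >> [set x | opath (shiftv [::] (B ^~ x)) v].
  exact: opath_sigma.
exact: (sub_sigma_measurable (@cylinders_measurable _ _ _ _ _ _ mB setT) h).
Qed.

Let measurable_opathb v b : measurable [set x | opath (B ^~ x) v = b].
Proof.
case: b; first exact: measurable_opath.
rewrite (_ : [set _ | _] = ~` [set x | opath (B ^~ x) v]).
  exact: measurableC.
by apply/seteqP; split => x /=; [move=> ->|move/negP/negbTE].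
Qed.

Lemma measurable_bits_event r : measurable (bits_event r).
Proof. by elim: r => //= b r IH; exact: measurableI. Qed.

Lemma bits_event_char r x y : bits_event r x ->
  bits_event r y <-> forall i, (i < size r)%N ->
    opath (B ^~ y) (vtx c i) = opath (B ^~ x) (vtx c i).
Proof.
elim: r => [|b r IH] /=; first by split.
move=> [rx xb]; split.
  move=> [ry yb] i; rewrite ltnS leq_eqVlt => /predU1P[->|]; first by rewrite xb yb.
  by move: i; exact/IH.
move=> h; split; last by rewrite h.
by apply/IH => // i ir; apply: h; rewrite ltnS ltnW.
Qed.

Lemma truncE n x y :
  tree_trunc n (clust y) = tree_trunc n (clust x) <->
  forall i, (i < size (verts c n))%N ->
    opath (B ^~ y) (vtx c i) = opath (B ^~ x) (vtx c i).
Proof.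
split=> [h i ni|h].
  have /andP[Ti si] := vtx_mem lvl_ne ni.
  apply/idP/idP => o.
    have : tree_trunc n (clust y) (vtx c i) by split => //; apply/open_clusterE; rewrite Ti.
    by rewrite h => -[/open_clusterE/andP[]].
  have : tree_trunc n (clust x) (vtx c i) by split => //; apply/open_clusterE; rewrite Ti.
  by rewrite -h => -[/open_clusterE/andP[]].
have key v : intree c v -> (size v <= n)%N -> opath (B ^~ y) v = opath (B ^~ x) v.
  by move=> Tv sv; rewrite -(vidxK lvl_ne Tv); apply: h; exact: vidx_lt.
apply/seteqP; split => v [/open_clusterE/andP[Tv ov] sv]; split => //;
  apply/open_clusterE; rewrite Tv /=.
  by rewrite -key.
by rewrite key.
Qed.

Lemma bits_event_cluster n r x : size r = size (verts c n) -> bits_event r x ->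
  bits_event r = cluster_event B T n (tree_trunc n (clust x)).
Proof.
move=> sr rx; apply/seteqP; split => y.
  by move=> /(bits_event_char _ rx) h; apply/truncE; rewrite -sr.
by move=> /truncE h; apply/(bits_event_char _ rx); rewrite sr.
Qed.

Lemma trunc_sub n x : tree_trunc n (clust x) `<=` tree_trunc n T.
Proof. by move=> v [/open_clusterE/andP[Tv _] sv]; split => //; exact/gw_treeE. Qed.

Lemma bits_event_cons r : bits_event r =
  bits_event (false :: r) `|` bits_event (true :: r).
Proof.
rewrite /= -setIUr; apply/esym/setIidPl => x _ /=.
by case: (opath _ _); [right|left].
Qed.

Lemma cprob_cons M r : cprob M (bits_event r) =
  cprob M (bits_event (false :: r)) + cprob M (bits_event (true :: r)).
Proof.
rewrite [in LHS]bits_event_cons cprobU//; try exact: measurable_bits_event.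
by apply/seteqP; split => // x [[_ /= ->] [_]].
Qed.

(* The patterns on all vertices of [verts c L] are cluster events, for which the
   limit is known; the shorter ones follow by downward induction on their length. *)
Lemma is_cvg_bits r : cvgn (fun M => cprob M (bits_event r)).
Proof.
pose L := size r; have rL : (size r <= size (verts c L))%N.
  exact: ltnW (size_verts lvl_ne L).
move: rL; move jE : (size (verts c L) - size r)%N => j rL.
move: (L) rL jE => {}L; elim: j r => [|j IH] r rL jE.
  have sr : size r = size (verts c L) by lia.
  have [[x rx]|rn] := pselect (exists x, bits_event r x).
    rewrite (bits_event_cluster sr rx); apply/cvg_ex.
    by eexists; apply: cond_cvg; exact: trunc_sub.
  have -> : bits_event r = set0 by apply/seteqP; split => // x rx; apply: rn; exists x.
  rewrite (_ : (fun _ => _) = fun=> 0); first exact: is_cvg_cst.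
  by apply/funext => M; rewrite /cprob set0I measure0 mul0r.
have -> : (fun M => cprob M (bits_event r)) = (fun M =>
    cprob M (bits_event (false :: r)) + cprob M (bits_event (true :: r))).
  by apply/funext => M; exact: cprob_cons.
move: rL jE IH; move: (size (verts c L)) => N rL jE IH.
by apply: is_cvgD; apply: IH; rewrite -[size _]/((size r).+1); lia.
Qed.

Definition mass (r : seq bool) : R := limn (fun M => cprob M (bits_event r)).

Lemma mass_ge0 r : 0 <= mass r.
Proof. by apply: limr_ge; [exact: is_cvg_bits|apply: nearW => M; exact: cprob_ge0]. Qed.

(** From [M0] on the conditioning event has positive probability, so the quotient is 1 and not the
    default value 0 of a division by 0. *)
Lemma mass_nil : mass [::] = 1.
Proof.
apply: cvg_lim => //; apply: cvg_near_cst.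
exists M0 => // M /= MM; rewrite /cprob setTI divff//.
by rewrite (connect_event_prob mB indB probB)/= gt_eqF// surv_pos.
Qed.

Lemma mass_cons r : mass r = mass (false :: r) + mass (true :: r).
Proof.
rewrite /mass -limD; try exact: is_cvg_bits.
by congr (lim (_ @ \oo)); apply/funext => M; exact: cprob_cons.
Qed.

(** If the pattern met no connection event of high level, its conditional probabilities would
    eventually be 0. Being joined to generation K + L implies being joined to generation L. *)
Lemma mass_pos r L : 0 < mass r -> exists x, bits_event r x /\ connect_event B T L x.
Proof.
move=> r0; have := @is_cvg_bits r; rewrite -/(mass r) => /cvgrPdist_lt/(_ _ r0)[K _ hK].
have [x [rx cx]] : exists x, bits_event r x /\ connect_event B T (K + L) x.
  apply: contrapT => nx; have := hK (K + L)%N (leq_addr _ _).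
  rewrite /= -/(mass r) /cprob (_ : _ `&` _ = set0); last first.
    by apply/seteqP; split => // x [rx cx]; apply: nx; exists x.
  by rewrite measure0 mul0r subr0 gtr0_norm// ltxx.
exists x; split => //; move: cx; rewrite !connect_event_conn /= addnC conn_cat connE.
by move=> /hasP[v vl /andP[ov _]]; apply/hasP; exists v.
Qed.

Let D : set R := `[0, 1[%classic `\` null_cells mass.

Let measurable_D : measurable D.
Proof.
apply: measurableD; first exact: measurable_itv.
exact: measurable_null_cells.
Qed.

(** Paths are stored latest choice first, so the head of the path of length [i.+1] is the choice
    made for [vtx c i]; this path is never empty. *)
Let bit (x : R) (i : nat) : bool := head false (cell_path mass x i.+1).

Definition subtree_of (x : R) : set vertex := [set v | intree c v && bit x (vidx c v)].

Lemma bits_event_path x n y : bits_event (cell_path mass x n) y <->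
  forall i, (i < n)%N -> opath (B ^~ y) (vtx c i) = bit x i.
Proof.
elim: n => [|n IH]; first by split.
split.
  move=> /= [/IH h yb] i; rewrite ltnS leq_eqVlt => /predU1P[->|]; last exact: h.
  by rewrite /bit /= -yb size_cell_path.
move=> h; split; first by apply/IH => i ni; apply: h; rewrite ltnS ltnW.
by rewrite /= size_cell_path h.
Qed.

(* Outside the null cells, every finite piece of the random subtree is a piece of
   an actual cluster that reaches generation [L]. *)
Lemma subtree_of_cluster x L : D x -> exists y,
  [/\ forall n, (n <= L)%N -> tree_trunc n (subtree_of x) = tree_trunc n (clust y),
    connect_event B T L y &
    forall i, (i < size (verts c L))%N -> opath (B ^~ y) (vtx c i) = bit x i].
Proof.
move=> [x01 xn]; move: x01; rewrite /= in_itv/= => x01.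
pose r := cell_path mass x (size (verts c L)).
have rx : cell mass r x.
  by apply/cellP; [exact: mass_ge0|exact: mass_nil|exact: mass_cons|];
    rewrite /r size_cell_path.
have r0 : 0 < mass r by apply: (null_cellsP _ rx) => //; exact: mass_ge0.
have [y [ry cy]] := mass_pos L r0; exists y.
move: ry => /bits_event_path h; split => // n nL.
have key v : intree c v -> (size v <= n)%N -> opath (B ^~ y) v = bit x (vidx c v).
  move=> Tv sv; rewrite -h ?vidxK//; apply: vidx_lt => //; exact: leq_trans nL.
apply/seteqP; split => v.
  move=> [/andP[Tv bv] sv]; split => //; apply/open_clusterE.
  by rewrite Tv key.
move=> [/open_clusterE/andP[Tv ov] sv]; split => //.
by rewrite /subtree_of /= Tv -(key _ Tv).
Qed.

(** Each instance of the property concerns finitely many generations, where the set coincides with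
    an actual cluster. *)
Lemma subtree_of_rooted x : D x -> rooted_tree (subtree_of x).
Proof.
move=> Dx; split.
  have [y [/(_ 0%N (leqnn _)) h _ _]] := subtree_of_cluster 0 Dx.
  have : tree_trunc 0 (clust y) [::] by split => //; exact: rst_refl.
  by rewrite -h => -[].
move=> v i vi; have [y [/(_ _ (leqnn _)) h _ _]] := subtree_of_cluster (size (rcons v i)) Dx.
have : tree_trunc (size (rcons v i)) (subtree_of x) (rcons v i) by split.
rewrite h => -[/open_clusterE]; rewrite opath_rcons -cats1 intree_cat.
move=> /andP[/andP[Tv _] /andP[ov _]] _.
have : tree_trunc (size (v ++ [:: i])) (clust y) v.
  by split; [apply/open_clusterE; rewrite Tv|rewrite size_cat leq_addr].
by rewrite cats1 -h => -[].
Qed.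

(** With [L] one more than the largest depth of a finite subtree, the approximating cluster still
    reaches generation [L]. *)
Lemma subtree_of_infinite x : D x -> infinite_set (subtree_of x).
Proof.
move=> Dx fin.
have /finite_seqP[s sE] := fin.
pose L := (\max_(v <- s) size v).+1.
have [y [/(_ _ (leqnn _)) h [v [Tv sv] cv] _]] := subtree_of_cluster L Dx.
have : tree_trunc L (clust y) v by split => //; rewrite sv.
rewrite -h => -[xv _].
have : v \in s by move: xv; rewrite sE.
move=> vs; have : (size v <= \max_(v <- s) size v)%N by exact: leq_bigmax_seq.
by rewrite sv ltnn.
Qed.

Lemma subtree_of_sub x : subtree_of x `<=` T.
Proof. by move=> v /andP[Tv _]; exact/gw_treeE. Qed.

Lemma cells_measure r : lebesgue_measure (D `&` cell mass r) = (mass r)%:E.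
Proof.
rewrite -(cell_measure mass_ge0 r).
have mC : measurable (D `&` cell mass r).
  by apply: measurableI => //; exact: measurable_cell.
have mN := measurable_null_cells mass.
apply/eqP; rewrite eq_le; apply/andP; split.
  by apply: le_measure; rewrite ?inE//; exact: measurable_cell.
have <- : lebesgue_measure ((D `&` cell mass r) `|` null_cells mass) =
    lebesgue_measure (D `&` cell mass r).
  by apply: measureU0 => //; exact: null_cells_measure0 mass_ge0.
apply: le_measure; rewrite ?inE//; first exact: measurable_cell.
  exact: measurableU.
move=> x rx; have [xN|xN] := pselect (null_cells mass x); [by right|left].
split => //; split => //.
by have /(cellP mass_ge0 mass_nil mass_cons)[+ _] := rx; rewrite /= in_itv.
Qed.

(** A tree [t] realized by some configuration [y] prescribes all bits up to generation [n], and so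
    corresponds to the single cell of this pattern. If no configuration realizes [t], both sides
    vanish. *)
Lemma cylinder_cells n t : t `<=` tree_trunc n T ->
  exists A : set R, [/\ measurable A,
    D `&` [set x | tree_trunc n (subtree_of x) = t] = D `&` A &
    lebesgue_measure (D `&` A) = (iic_marginal Q B T mu n t)%:E].
Proof.
move=> tT.
have [[y yt]|ny] := pselect (exists y, cluster_event B T n t y); last first.
  have t0 : cluster_event B T n t = set0.
    by apply/seteqP; split => // y yt; apply: ny; exists y.
  exists set0; split => //.
    rewrite setI0; apply/seteqP; split => // x [Dx /= xt]; apply: ny.
    have [y [/(_ _ (leqnn _)) h _ _]] := subtree_of_cluster n Dx.
    by exists y; rewrite /cluster_event /= -xt h.
  by rewrite setI0 measure0 /iic_marginal /cluster_prob t0 measure0 mulr0.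
(* The pattern of the cluster of [y], latest bit first. *)
pose pat := fix pat k := if k is k'.+1 then opath (B ^~ y) (vtx c k') :: pat k' else [::].
have size_pat k : size (pat k) = k by elim: k => //= k ->.
have paty k : bits_event (pat k) y.
  by elim: k => //= k IH; split => //=; rewrite size_pat.
pose r := pat (size (verts c n)).
have rE : bits_event r = cluster_event B T n t.
  by rewrite (bits_event_cluster (size_pat _) (paty _)) yt.
have mr : mass r = iic_marginal Q B T mu n t.
  by apply: cvg_lim => //; rewrite rE; exact: cond_cvg.
exists (cell mass r); split; first exact: measurable_cell.
  apply/seteqP; split => x [Dx h]; split => //.
    have [z [/(_ _ (leqnn _)) zt _ zb]] := subtree_of_cluster n Dx.
    have /truncE zy : tree_trunc n (clust z) = tree_trunc n (clust y).
      by rewrite -zt yt.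
    apply/cellP; [exact: mass_ge0|exact: mass_nil|exact: mass_cons|].
    split; first by case: Dx => + _; rewrite /= in_itv.
    rewrite size_pat /r.
    suff: forall k, (k <= size (verts c n))%N -> cell_path mass x k = pat k by exact.
    elim=> // k IH kn; rewrite -[LHS]/(bit x k :: cell_path mass x k) IH ?(ltnW kn)//.
    by rewrite -zb// zy.
  move: h => /(cellP mass_ge0 mass_nil mass_cons)[_ xr].
  have : bits_event (cell_path mass x (size r)) y by rewrite xr; exact: paty.
  move=> /bits_event_path yb; rewrite size_pat in yb.
  have [z [/(_ _ (leqnn _)) zt _ zb]] := subtree_of_cluster n Dx.
  rewrite /= zt -yt; apply/truncE => i ni; by rewrite zb// yb.
by rewrite cells_measure mr.
Qed.

Let phi (x : R) : tree_space :=
  match pselect (D x) with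
  | left Dx => InfTree (subtree_of_rooted Dx) (subtree_of_infinite Dx)
  | right _ => point
  end.

Let phiE x : D x -> tree_set (phi x) = subtree_of x.
Proof. by rewrite /phi; case: pselect. Qed.

Let phi_cylinder n t : D `&` phi @^-1` tree_cylinder n t =
  D `&` [set x | tree_trunc n (subtree_of x) = t].
Proof.
by apply/seteqP; split => x [Dx h]; split => //; move: h;
  rewrite /tree_cylinder /= phiE.
Qed.

(** Cylinders suffice. On [D] their preimages are given by cells, and off [D] the map is
    constant. *)
Let measurable_phi : measurable_fun setT phi.
Proof.
apply: (@measurability _ _ _ tree_space setT phi tree_cylinders) => //.
move=> _ [_ [n [t ->]] <-]; rewrite setTI.
rewrite -(setUIDK (phi @^-1` _) D) [_ `&` D]setIC; apply: measurableU.
  rewrite phi_cylinder; have [tT|tT] := pselect (t `<=` tree_trunc n T).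
    have [A [mA -> _]] := cylinder_cells tT; exact: measurableI.
  rewrite (_ : _ `&` _ = set0)//; apply/seteqP; split => // x [_ /= xt]; apply: tT.
  by rewrite -xt => v [/subtree_of_sub Tv sv].
have [pt|pt] := pselect (tree_cylinder n t point).
  rewrite (_ : _ `\` _ = ~` D); first exact: measurableC.
  by apply/seteqP; split => x; [case|move=> nD; split => //; rewrite /= /phi; case: pselect].
rewrite (_ : _ `\` _ = set0)//; apply/seteqP; split => // x [+ nD].
by rewrite /= /phi; case: pselect.
Qed.

Lemma iic_exists : exists nu : probability tree_space R,
  is_iic_measure Q B mu T nu.
Proof.
pose Rm := measurableTypeR R.
pose lam : {measure set Rm -> \bar R} := mrestr (@lebesgue_measure R) measurable_D.
have lam1 : lam setT = 1%E.
  (* [cell mass [::]] is [0, 1[, so the total mass is that of the empty pattern. *)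
  rewrite /lam/= /mrestr setTI (_ : D = D `&` cell mass [::]).
    by rewrite cells_measure mass_nil.
  apply/esym/setIidPl => x [x01 _].
  apply/cellP; [exact: mass_ge0|exact: mass_nil|exact: mass_cons|].
  by split => //; move: x01; rewrite /= in_itv.
pose lamP : probability Rm R :=
  HB.pack (mrestr (@lebesgue_measure R) measurable_D)
    (Measure_isProbability.Build _ _ _ (mrestr (@lebesgue_measure R) measurable_D) lam1).
pose phiM : {mfun Rm >-> tree_space} :=
  HB.pack (phi : Rm -> tree_space) (isMeasurableFun.Build _ _ Rm _ phi measurable_phi).
exists (distribution lamP phiM); split.
  rewrite /distribution /pushforward /= /lam /= /mrestr.
  rewrite (_ : _ `&` _ = setT `&` D); first exact: lam1.
  rewrite setTI; apply/seteqP; split => x; first by case.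
  move=> Dx; split => //=; rewrite phiE//; exact: subtree_of_sub.
move=> n t tT _; have [A [mA DA lA]] := cylinder_cells tT.
rewrite /distribution /pushforward /= /lam /= /mrestr setIC.
by rewrite phi_cylinder DA lA.
Qed.

End iic_existence.

(** * Uniqueness of the measure *)

Section tree_space_measurability.
Variable c : vertex -> nat.

Let sub_verts n (m : (size (verts c n)).-tuple bool) : set vertex :=
  [set` mask (val m) (verts c n)].

(** [S] lies in the tree iff each truncation of [S] is one of the finitely many subsets of the
    truncated tree, listed by Boolean masks. This makes the event of concentration measurable. *)
Lemma subtreesE : [set S : tree_space | (tree_set S : set vertex) `<=` gw_tree c] =
  \bigcap_n \bigcup_(m in [set: (size (verts c n)).-tuple bool])
    tree_cylinder n (sub_verts m).
Proof.
apply/seteqP; split => S /=.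
  move=> ST n _.
  have sz : size [seq v \in tree_set S | v <- verts c n] == size (verts c n).
    by rewrite size_map.
  have key (vs : seq vertex) :
      (forall v, (v \in vs) = intree c v && (size v <= n)%N) ->
      tree_trunc n S = [set` [seq v <- vs | v \in tree_set S]].
    move=> vsE; apply/seteqP; split => v /=.
      move=> [Sv sv]; rewrite mem_filter mem_set//= vsE sv andbT.
      exact/gw_treeE/ST.
    by rewrite mem_filter vsE => /andP[/set_mem Sv /andP[_ sv]].
  exists (Tuple sz) => //; rewrite /tree_cylinder.
  apply: etrans (key _ (@mem_verts c n)) _.
  by rewrite filter_mask.
move=> h v Sv; have [m _ hm] := h (size v) I.
have : tree_trunc (size v) S v by split.
rewrite hm /sub_verts /= => /mem_mask; rewrite mem_verts => /andP[Tv _].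
exact/gw_treeE.
Qed.

Lemma measurable_cylinder n t : measurable (tree_cylinder n t : set tree_space).
Proof. by apply: sub_sigma_algebra; exists n, t. Qed.

Lemma measurable_subtrees :
  measurable [set S : tree_space | (tree_set S : set vertex) `<=` gw_tree c].
Proof.
rewrite subtreesE; apply: bigcap_measurable => [|n _]; first by exists 0%N.
apply: fin_bigcup_measurable; first exact: finite_finset.
by move=> m _; exact: measurable_cylinder.
Qed.

End tree_space_measurability.

Lemma tree_trunc_trunc m n (S : set vertex) : (m <= n)%N ->
  tree_trunc m (tree_trunc n S) = tree_trunc m S.
Proof.
move=> mn; apply/seteqP; split => v; first by move=> [[Sv _] sv].
by move=> [Sv sv]; split => //; split => //; exact: leq_trans mn.
Qed.

(** Trees contain the root; this exhibits the empty set as a cylinder, for the case of disjoint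
    cylinders in [tree_cylinders_setI]. *)
Lemma tree_cylinder_set0 : tree_cylinder 0 set0 = set0.
Proof.
apply/seteqP; split => // S /= S0.
have : tree_trunc 0 S [::] by split => //; exact: (inf_tree_rooted S).1.
by rewrite S0.
Qed.

(** Two cylinders are nested or disjoint, since the deeper truncation determines the shallower
    one. *)
Lemma tree_cylinders_setI : setI_closed tree_cylinders.
Proof.
have h m n t s : (m <= n)%N ->
    tree_cylinders (tree_cylinder m t `&` tree_cylinder n s).
  move=> mn; have [st|st] := pselect (tree_trunc m s = t).
    exists n, s; apply/seteqP; split => S; first by case.
    by move=> Ss; split => //; rewrite /tree_cylinder /= -st -(tree_trunc_trunc _ mn) Ss.
  exists 0%N, set0; rewrite tree_cylinder_set0; apply/seteqP; split => // S [/= St Ss].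
  by apply: st; rewrite -Ss tree_trunc_trunc.
move=> _ _ [m [t ->]] [n [s ->]]; have [mn|/ltnW nm] := leqP m n; first exact: h.
by rewrite setIC; exact: h.
Qed.

Lemma tree_trunc_rooted n S : rooted_tree S -> rooted_tree (tree_trunc n S).
Proof.
move=> [S0 Sr]; split; first by split.
move=> v i [Svi svi]; split; first exact: Sr Svi.
by rewrite (leq_trans _ svi)// size_rcons.
Qed.

(** Cylinders form a pi-system, so it suffices to compare on them. The marginals settle rooted [t]
    inside the tree; if [t] is not inside it, concentration makes the cylinder null, and if [t] is
    not rooted, the cylinder is empty. *)
Lemma iic_unique d (Xi : measurableType d) (R : realType)
    (Q : probability Xi R) (B : vertex -> Xi -> bool) (mu : R) (c : vertex -> nat)
    (nu nu' : probability tree_space R) :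
  is_iic_measure Q B mu (gw_tree c) nu -> is_iic_measure Q B mu (gw_tree c) nu' ->
  forall A : set tree_space, measurable A -> nu' A = nu A.
Proof.
move=> [nuT nuM] [nuT' nuM'].
pose m1 : {measure set tree_space -> \bar R} := nu'.
pose m2 : {measure set tree_space -> \bar R} := nu.
suff: forall A, measurable A -> m1 A = m2 A by [].
have null (nu0 : probability tree_space R) n t :
    nu0 [set S : inf_tree | (S : set vertex) `<=` gw_tree c] = 1%E ->
    ~ (t `<=` tree_trunc n (gw_tree c)) -> nu0 (tree_cylinder n t) = 0%E.
  move=> nu01 tT; apply/eqP; rewrite eq_le measure_ge0 andbT.
  have mS := measurable_subtrees c.
  have <- : nu0 (~` [set S : tree_space | (tree_set S : set vertex) `<=` gw_tree c]) = 0%E.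
    by rewrite probability_setC// nu01 subee.
  apply: le_measure; rewrite ?inE; [exact: measurable_cylinder|exact: measurableC|].
  move=> S /= SE ST; apply: tT; rewrite -SE => v [Sv sv]; split => //; exact: ST.
have cyl n t : m1 (tree_cylinder n t) = m2 (tree_cylinder n t).
  have [tT|tT] := pselect (t `<=` tree_trunc n (gw_tree c)); last first.
    exact: etrans (null _ _ _ nuT' tT) (esym (null _ _ _ nuT tT)).
  have [tr|tr] := pselect (rooted_tree t).
    exact: etrans (nuM' _ _ tT tr) (esym (nuM _ _ tT tr)).
  rewrite (_ : tree_cylinder n t = set0) ?measure0//.
  apply/seteqP; split => // S /= SE; apply: tr; rewrite -SE.
  exact: tree_trunc_rooted (inf_tree_rooted S).
have cylT : tree_cylinder 0 [set [::]] = setT.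
  apply/seteqP; split => // S _; apply/seteqP; split => v.
    by move=> [_]; rewrite leqn0 size_eq0 => /eqP.
  by move=> ->; split => //; exact: (inf_tree_rooted S).1.
apply: (@measure_unique _ R tree_space tree_cylinders (fun=> setT)) => //.
- exact: tree_cylinders_setI.
- by move=> _; exists 0%N, [set [::]].
- by rewrite bigcup_const.
- by move=> _ [n [t ->]]; exact: cyl.
- by move=> _; rewrite /m1 -ge0_fin_numE//; exact: fin_num_measure.
Qed.

Lemma lvl_nil_add c n k : lvl c n = [::] -> lvl c (n + k) = [::].
Proof.
move=> ln; case E : (lvl c (n + k)) => [//|u s].
have : u \in lvl c (n + k) by rewrite E mem_head.
rewrite mem_lvl => /andP[Tu /eqP su].
have : take n u \in lvl c n.
  rewrite mem_lvl size_take su.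
  have : intree c (take n u ++ drop n u) by rewrite cat_take_drop.
  rewrite intree_cat => /andP[-> _] /=.
  by case: ltngtP => //; lia.
by rewrite ln.
Qed.

Section good_field.
Context (R : realType) (mu : R) (r : nat -> R) (c : vertex -> nat).
Hypothesis r_gt0 : forall k, 0 < r k.
Hypothesis cgood : forall v, exists w : R, [/\ 0 < w,
  (fun k => gwW mu^-1 k (shiftv v c)) @ \oo --> w &
  (fun k => surv mu^-1 k (shiftv v c) / r k) @ \oo --> w].

(** An empty generation would make W_k vanish eventually, against its positive limit. *)
Lemma good_lvl n : lvl c n != [::].
Proof.
apply/negP => /eqP ln; have [w [w0 Ww _]] := cgood [::].
have W0 : (fun k => gwW mu^-1 k (shiftv [::] c)) @ \oo --> (0 : R).
  apply: cvg_near_cst; exists n => // k /= /subnKC <-.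
  by rewrite gwW_lvl lvl_nil_add// mul0r.
have w00 : w = 0 by exact: (cvg_unique _ Ww W0).
by rewrite w00 ltxx in w0.
Qed.

Lemma good_surv : exists M0, forall M, (M0 <= M)%N -> 0 < surv mu^-1 M c.
Proof.
have [w [w0 _ sw]] := cgood [::].
have [M0 _ hM] := cvgr_gt w sw _ w0; exists M0 => M MM.
by have := hM M MM; rewrite /= pmulr_lgt0// invr_gt0.
Qed.

End good_field.

(** * Transfer between the offspring variables and the law of their field *)

Section offspring_law.
Context d (Omega : measurableType d) (R : realType) (P : probability Omega R).
Variables (Z : {RV P >-> nat}) (N : vertex -> {RV P >-> nat}).
Hypothesis N_indep : mutually_independent P (fun v => N v : Omega -> nat).
Hypothesis N_distr : forall v (A : set nat),
  distribution P (N v) A = distribution P Z A.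

Definition offspring_field (w : Omega) : env := fun v => N v w.

Lemma measurable_offspring_field : measurable_fun setT offspring_field.
Proof. by apply: measurable_to_env => v; exact: measurable_funPT. Qed.

Definition offspring_mfun : {mfun Omega >-> env} :=
  HB.pack offspring_field
    (isMeasurableFun.Build _ _ _ _ offspring_field measurable_offspring_field).

(** The estimates need a space on which passing to a subtree is a map; they are made under this
    image law and pulled back by [ae_offspring]. *)
Definition offspring_law : probability env R := distribution P offspring_mfun.

Lemma gw_offspring_law : gw_law offspring_law.
Proof.
split=> [F A mA|u A]; first exact: N_indep.
exact: etrans (N_distr u A) (esym (N_distr [::] A)).
Qed.

Lemma mean_offspring (h : nat -> R) a : (forall z, 0 <= h z) ->
  (\int[P]_w (h (Z w))%:E = a%:E)%E ->
  has_mean offspring_law setT (fun e : env => h (e [::])) a.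
Proof.
move=> h0 ha.
have mh : measurable_fun setT (fun e : env => h (e [::])).
  by apply: (measurableT_comp (f := h)) => //; exact: measurable_env.
have E : (\int[offspring_law]_e (h (e [::]))%:E = a%:E)%E.
  have hE (X : {RV P >-> nat}) :
      (\int[distribution P X]_z (h z)%:E = \int[P]_w (h (X w))%:E)%E.
    by rewrite ge0_integral_distribution// => z; rewrite lee_fin.
  rewrite ge0_integral_distribution//; last 2 first.
  - exact/measurable_EFinP.
  - by move=> e; rewrite lee_fin.
  rewrite -ha -hE; apply: etrans (esym (hE (N [::]))) _.
  by apply: eq_measure_integral => A _ _; exact: N_distr.
split => //; apply/integrableP; split; first exact/measurable_EFinP.
under eq_integral do rewrite /= ger0_norm//.
by rewrite E ltry.
Qed.

Lemma ae_offspring (Pr : env -> Prop) : {ae offspring_law, forall e, Pr e} ->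
  {ae P, forall w, Pr (offspring_field w)}.
Proof.
move=> [A [mA A0 PA]]; exists (offspring_field @^-1` A); split => //.
- by have := measurable_offspring_field measurableT mA; rewrite setTI.
- by move=> w /= h; exact: PA.
Qed.

End offspring_law.

Theorem lemma3p9 (R : realType)
    (d : measure_display) (Omega : measurableType d) (P : probability Omega R)
    (Z : {RV P >-> nat}) (mu : R)
    (Z_pos : forall w, (0 < Z w)%N)
    (Z_mean : ('E_P[fun w => (Z w)%:R%R] = mu%:E)%E)
    (mu_gt1 : 1 < mu)
    (Z_fourth : ('E_P[fun w => ((Z w)%:R ^+ 4)%R] < +oo)%E)
    (N : vertex -> {RV P >-> nat})
    (N_indep : mutually_independent P (fun v => N v : Omega -> nat))
    (N_distr : forall v (A : set nat),
       distribution P (N v) A = distribution P Z A)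
    (d' : measure_display) (Xi : measurableType d') (Q : probability Xi R)
    (B : vertex -> {RV Q >-> bool})
    (B_indep : mutually_independent Q (fun v => B v : Xi -> bool))
    (B_distr : forall v : vertex, Q [set x | B v x = true] = (mu^-1)%:E) :
  let T (w : Omega) : set vertex := gw_tree (fun v => N v w) in
  {ae P, forall w, forall (n : nat) (t : set vertex),
     t `<=` tree_trunc n (T w) -> rooted_tree t ->
     (fun M => cond_cluster_prob Q (fun v => B v) (T w) M n t) @ \oo -->
       iic_marginal Q (fun v => B v) (T w) mu n t} /\
  {ae P, forall w, exists nu : probability tree_space R,
     is_iic_measure Q (fun v => B v) mu (T w) nu /\
     forall nu' : probability tree_space R,
       is_iic_measure Q (fun v => B v) mu (T w) nu' ->
       forall A : set tree_space, measurable A -> nu' A = nu A}.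
Proof.
move=> T.
have mB v : measurable_fun setT (B v : Xi -> bool) by exact: measurable_funPT.
pose G := offspring_law N; have GW : gw_law G := gw_offspring_law N_indep N_distr.
have mean1 : has_mean G setT (fun e : env => (e [::])%:R) mu.
  apply: (mean_offspring N_distr (h := fun z => z%:R)) => //.
  by rewrite -Z_mean unlock.
have E4 : exists m4, (\int[P]_w ((Z w)%:R ^+ 4)%:E = m4%:E)%E.
  move: Z_fourth; rewrite unlock => h4.
  have h0 : (0 <= \int[P]_w ((Z w)%:R ^+ 4)%:E)%E.
    by apply: integral_ge0 => w _; rewrite lee_fin exprn_ge0.
  exists (fine (\int[P]_w ((Z w)%:R ^+ 4)%:E)%E); rewrite fineK//.
  by rewrite ge0_fin_numE.
have [m4 Em4] := E4.
have mean4 : has_mean G setT (fun e : env => (e [::])%:R ^+ 4) m4.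
  by apply: (mean_offspring N_distr (h := fun z => z%:R ^+ 4)) => // z; exact: exprn_ge0.
(* The second moment is finite because z^2 <= z^4 for natural numbers. *)
have [m2 mean2] : exists m2, has_mean G setT (fun e : env => (e [::])%:R ^+ 2 : R) m2.
  apply: (mean_dominated _ _ mean4).
    by apply: measurable_funX; exact: mean_measurable mean1.
  move=> e; rewrite ger0_norm ?sqr_ge0// -!natrX ler_nat.
  by case: (e [::]) => // z; rewrite leq_pexp2l.
have root_pos : G (root_count 0) = 0%E.
  apply: etrans (N_distr [::] [set 0%N]) _.
  rewrite /distribution /pushforward (_ : _ @^-1` _ = set0) ?measure0//.
  by apply/seteqP; split => // w /= Z0; have := Z_pos w; rewrite Z0.
have [r [r0 rcvg rratio rG]] := ae_surv_gwW GW mean1 mean2 mean4 mu_gt1 root_pos.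
(* The convergence at the root is extended to all labels outside a single null set, which then
   serves every [n] and [t] and both claims. *)
have good := ae_offspring (ae_shift GW rG).
have part1 : {ae P, forall w, forall (n : nat) (t : set vertex),
     t `<=` tree_trunc n (T w) ->
     (fun M => cond_cluster_prob Q (fun v => B v) (T w) M n t) @ \oo -->
       iic_marginal Q (fun v => B v) (T w) mu n t}.
  case: good => A [mA A0 hA]; exists A; split => // w /= nw; apply: hA => /= h.
  by apply: nw => n t tT; exact: (cond_cluster_cvg mB B_indep B_distr r0 rcvg rratio h tT).
split.
  case: part1 => A [mA A0 hA]; exists A; split => // w /= nw; apply: hA => /= h.
  by apply: nw => n t tT _; exact: h.
case: good => A [mA A0 hA]; exists A; split => // w /= nw; apply: hA => /= h.
apply: nw; have [M0 hM0] := good_surv r0 h.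
have [nu hnu] := iic_exists mB B_indep B_distr (good_lvl h)
  (cond_cluster_cvg mB B_indep B_distr r0 rcvg rratio h) hM0.
by exists nu; split => // nu' hnu'; exact: iic_unique hnu hnu'.
Qed.
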